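(* Up to isomorphism, the unique indecomposable $2$-step nilpotent real Lie algebras of dimension seven carrying a coclosed $\mathrm{G}_2$-structure are the following seven: \begin{align*} 17&=(0,0,0,0,0,0,12+34+56),\\ 37A&=(0,0,0,0,12,23,24),\\ 37B&=(0,0,0,0,12,23,34),\\ 37B1&=(0,0,0,0,12-34,13+24,14),\\ 37C&=(0,0,0,0,12+34,23,24),\\ 37D&=(0,0,0,0,12+34,13,24),\\ 37D1&=(0,0,0,0,12-34,13+24,14-23). \end{align*}
   Context: Notation: a $7$-tuple such as $(0,0,0,0,12,23,12-34)$ denotes the $7$-dimensional real Lie algebra $\mathfrak{g}$ whose dual has a basis $\{e^1,\dots,e^7\}$ with $de^i$ equal to the $i$-th entry, where $d$ is the Chevalley–Eilenberg differential and $ij$ stands for $e^{ij}=e^i\wedge e^j$; so in this example $de^1=\dots=de^4=0$, $de^5=e^{12}$, $de^6=e^{23}$, $de^7=e^{12}-e^{34}$. A Lie algebra is decomposable if it is the direct sum of two (non-zero) ideals, and indecomposable otherwise. It is $2$-step nilpotent if it is non-abelian and $[\mathfrak{g},[\mathfrak{g},\mathfrak{g}]]=0$. A $\mathrm{G}_2$-structure on a $7$-dimensional real Lie algebra $\mathfrak{g}$ is a positive $3$-form $\varphi\in\Lambda^3(\mathfrak{g}^* )$, i.e. one for which there is a coframe $\{e^1,\dots,e^7\}$ of $\mathfrak{g}^*$ with $\varphi=e^{127}+e^{347}+e^{567}+e^{135}-e^{146}-e^{236}-e^{245}$. It determines the inner product making $\{e^i\}$ orthonormal and the orientation $e^{1\cdots7}$,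 and its Hodge dual is $\phi=\star_\varphi\varphi=e^{1234}+e^{1256}+e^{1367}+e^{1457}+e^{2357}-e^{2467}+e^{3456}$. It is coclosed if $d\phi=0$. *)

(* Defs.v *)
From HB Require Import structures.
From mathcomp Require Import all_boot all_order all_algebra.
From mathcomp Require Import functions reals.
From mathcomp Require Import ring.

Set Implicit Arguments.
Unset Strict Implicit.
Unset Printing Implicit Defensive.

Import GRing.Theory.
Local Open Scope ring_scope.

Record lie_bracket_axioms (K : fieldType) (V : vectType K)
    (br : V -> V -> V) : Prop := LieBracketAxioms {
  lie_bracket_linear_l : forall y, linear (br^~ y);
  lie_bracket_linear_r : forall x, linear (br x);
  lie_bracket_alternating : forall x, br x x = 0;
  lie_bracket_jacobi :
    forall x y z, br x (br y z) + br y (br z x) + br z (br x y) = 0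
}.

HB.mixin Record Vector_isLieAlgebra (K : fieldType) (L : Type)
    of Vector K L := {
  lie_bracket : L -> L -> L;
  lie_bracketP : lie_bracket_axioms lie_bracket
}.

#[short(type="lieAlgType")]
HB.structure Definition LieAlgebra (K : fieldType) :=
  { L of Vector_isLieAlgebra K L & Vector K L }.

Section LieAlgebras.
Variable K : fieldType.

Definition lie_isomorphic (g h : lieAlgType K) : Prop :=
  exists f : {linear g -> h},
    bijective f /\ forall x y : g, f (lie_bracket x y) = lie_bracket (f x) (f y).

Definition lie_ideal (g : lieAlgType K) (I : {vspace g}) : Prop :=
  forall x y : g, y \in I -> lie_bracket x y \in I.

Definition decomposable (g : lieAlgType K) : Prop :=
  exists I J : {vspace g},
    [/\ lie_ideal I, lie_ideal J, I != 0%VS, J != 0%VS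
      & (I + J)%VS = fullv /\ (I :&: J)%VS = 0%VS].

Definition indecomposable (g : lieAlgType K) : Prop := ~ decomposable g.

Definition lie_abelian (g : lieAlgType K) : Prop :=
  forall x y : g, lie_bracket x y = 0.

Definition two_step_nilpotent (g : lieAlgType K) : Prop :=
  ~ lie_abelian g /\ forall x y z : g, lie_bracket x (lie_bracket y z) = 0.

End LieAlgebras.

(* A k-form is represented by its values on k-tuples of vectors.  Alternating *)
(* multilinearity is not recorded in the type: the forms considered below are *)
(* linear combinations of monomials e^{i1...ik} or Hodge duals of such.       *)
Definition form (K : fieldType) (V : vectType K) (k : nat) : Type :=
  ('I_k -> V) -> K.

Section Forms.
Variables (K : fieldType) (V : vectType K).

(* theta_{i1} /\ ... /\ theta_{ik}, for a family theta of 1-forms, normalized *)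
(* so that (a /\ b)(x, y) = a x * b y - b x * a y.                            *)
Definition monomial (theta : nat -> V -> K) (k : nat) (i : k.-tuple nat) :
    form V k :=
  fun x => \det (\matrix_(p < k, q < k) theta (tnth i p) (x q)).

(* Coframes are given through their dual frames E; following the usual        *)
(* notation e^1, ..., e^n, indices start from 1.                              *)
Definition coframe (n : nat) (E : n.+1.-tuple V) (i : nat) (x : V) : K :=
  coord E (inord i.-1) x.

Definition volume_form (n : nat) (E : n.-tuple V) : form V n :=
  fun x => \det (\matrix_(p < n, q < n) coord E p (x q)).

Definition cat_args (k l : nat) (x : 'I_k -> V) (y : 'I_l -> V) :
    'I_(k + l) -> V :=
  fun m => match fintype.split m with inl p => x p | inr q => y q end.

(* Hodge star of the inner product and orientation for which the frame E is   *)
(* orthonormal and positively oriented:                                       *)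
(*   ( *a )_{j1...jl} = 1/k! \sum_{i1...ik} a_{i1...ik} eps_{i1...ik j1...jl},*)
(* so that a /\ *b = <a, b> vol and *e^I = e^J if vol = e^I /\ e^J.           *)
Definition hodge_star (k l : nat) (E : (k + l).-tuple V) (a : form V k) :
    form V l :=
  fun y => (k`!%:R)^-1 *
    \sum_(i : {ffun 'I_k -> 'I_(k + l)})
      a (fun p => tnth E (i p)) *
      volume_form E (cat_args (fun p => tnth E (i p)) y).

End Forms.

(* Chevalley-Eilenberg differential                                           *)
(*   (da)(x_0, ..., x_{k+1}) =                                                *)
(*     \sum_{s < t} (-1)^{s+t} a([x_s, x_t], x_0, .., x_s^, .., x_t^, ..)     *)
(* where t ranges over the values lift s j = j.+1 with s <= j.                *)
Definition ce_diff (K : fieldType) (g : lieAlgType K) (k : nat)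
    (a : form g k.+1) : form g k.+2 :=
  fun x => \sum_(s < k.+2) \sum_(j < k.+1 | (s <= j)%N)
    (-1) ^+ (s + lift s j) *
    a (fun m => match unlift ord0 m with
                | None => lie_bracket (x s) (x (lift s j))
                | Some l => x (lift s (lift j l))
                end).

Section G2.
Variables (R : realType) (g : lieAlgType R).

Definition G2_form (E : 7.-tuple g) : form g 3 :=
  let e i j k := monomial (coframe E) [tuple i; j; k] in
  e 1 2 7 + e 3 4 7 + e 5 6 7 + e 1 3 5 - e 1 4 6 - e 2 3 6 - e 2 4 5.

Definition adapted_frame (phi : form g 3) (E : 7.-tuple g) : Prop :=
  basis_of fullv E /\ phi = G2_form E.

Definition G2_structure (phi : form g 3) : Prop :=
  exists E : 7.-tuple g, adapted_frame phi E.

(* The inner product, the orientation, and hence the star are the same for    *)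
(* all frames adapted to phi.                                                 *)
Definition coclosed (phi : form g 3) : Prop :=
  exists2 E : 7.-tuple g,
    adapted_frame phi E & ce_diff (hodge_star (k := 3) (l := 4) E phi) = 0.

Definition carries_coclosed_G2_structure : Prop :=
  exists2 phi : form g 3, G2_structure phi & coclosed phi.

End G2.

Section StructureEquations.
Variable K : fieldType.
Implicit Types (de : 7.-tuple (form 'rV[K]_7 2)) (x y z : 'rV[K]_7).

Definition std_coframe (i : nat) (x : 'rV[K]_7) : K := x 0 (inord i.-1).

Definition e2 (i j : nat) : form 'rV[K]_7 2 :=
  monomial std_coframe [tuple i; j].

Definition pair_args (V : Type) (x y : V) : 'I_2 -> V :=
  fun m => if m == 0 then x else y.

(* The bracket whose Chevalley-Eilenberg differential maps e^i to the i-th    *)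
(* entry of de, since (da)(x, y) = - a([x, y]).                               *)
Definition bracket_of de x y : 'rV[K]_7 :=
  \row_i - tnth de i (pair_args x y).

Definition lie_of de (H : lie_bracket_axioms (bracket_of de)) : lieAlgType K :=
  HB.pack 'rV[K]_7 (Vector_isLieAlgebra.Build K 'rV[K]_7 H).

Lemma form0E v : (0 : form 'rV[K]_7 2) v = 0. Proof. by []. Qed.
Lemma formDE (a b : form 'rV[K]_7 2) v : (a + b) v = a v + b v.
Proof. by []. Qed.
Lemma formNE (a : form 'rV[K]_7 2) v : (- a) v = - a v. Proof. by []. Qed.

Lemma e2E i j x y : e2 i j (pair_args x y) =
  std_coframe i x * std_coframe j y - std_coframe i y * std_coframe j x.
Proof.
rewrite /e2 /monomial (expand_det_row _ ord0) !big_ord_recl big_ord0 addr0.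
rewrite /cofactor !det_mx11 !mxE /pair_args /= !(tnth_nth 0%N) /=.
by rewrite expr0 expr1 mul1r mulN1r mulrN.
Qed.

Lemma lie_of_ce_diff de (H : lie_bracket_axioms (bracket_of de))
    (i : 'I_7) (x y : 'rV[K]_7) :
  @ce_diff K (lie_of H) 0 (fun v => (v ord0 : 'rV[K]_7) 0 i) (pair_args x y)
  = tnth de i (pair_args x y).
Proof.
rewrite /ce_diff !big_ord_recl big_ord0 !big_mkcond /= !big_ord1 /= !addr0.
rewrite unlift_none mulN1r big_ord0 !addr0; apply: (canLR opprK).
by transitivity (bracket_of de x y 0 i); rewrite ?mxE.
Qed.

End StructureEquations.

Ltac prove_lie_bracket :=
  split=> [z a x y|z a x y|x|x y z]; apply/rowP;
  move=> -[[|[|[|[|[|[|[|k]]]]]]] Hk] //;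
  rewrite !mxE ?(tnth_nth 0) /= ?(form0E, formDE, formNE, e2E);
  rewrite /std_coframe ?mxE ?(tnth_nth 0) ?inordK //= ?(form0E, formDE, formNE);
  ring.

Inductive label := L17 | L37A | L37B | L37B1 | L37C | L37D | L37D1.

Section SevenAlgebras.
Variable K : fieldType.
Local Notation e := (@e2 K).

Definition eqs_17 : 7.-tuple (form 'rV[K]_7 2) :=
  [tuple 0; 0; 0; 0; 0; 0; e 1 2 + e 3 4 + e 5 6].
Lemma eqs_17P : lie_bracket_axioms (bracket_of eqs_17).
Proof. prove_lie_bracket. Qed.
Definition lie_17 : lieAlgType K := lie_of eqs_17P.

Definition eqs_37A : 7.-tuple (form 'rV[K]_7 2) :=
  [tuple 0; 0; 0; 0; e 1 2; e 2 3; e 2 4].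
Lemma eqs_37AP : lie_bracket_axioms (bracket_of eqs_37A).
Proof. prove_lie_bracket. Qed.
Definition lie_37A : lieAlgType K := lie_of eqs_37AP.

Definition eqs_37B : 7.-tuple (form 'rV[K]_7 2) :=
  [tuple 0; 0; 0; 0; e 1 2; e 2 3; e 3 4].
Lemma eqs_37BP : lie_bracket_axioms (bracket_of eqs_37B).
Proof. prove_lie_bracket. Qed.
Definition lie_37B : lieAlgType K := lie_of eqs_37BP.

Definition eqs_37B1 : 7.-tuple (form 'rV[K]_7 2) :=
  [tuple 0; 0; 0; 0; e 1 2 - e 3 4; e 1 3 + e 2 4; e 1 4].
Lemma eqs_37B1P : lie_bracket_axioms (bracket_of eqs_37B1).
Proof. prove_lie_bracket. Qed.
Definition lie_37B1 : lieAlgType K := lie_of eqs_37B1P.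

Definition eqs_37C : 7.-tuple (form 'rV[K]_7 2) :=
  [tuple 0; 0; 0; 0; e 1 2 + e 3 4; e 2 3; e 2 4].
Lemma eqs_37CP : lie_bracket_axioms (bracket_of eqs_37C).
Proof. prove_lie_bracket. Qed.
Definition lie_37C : lieAlgType K := lie_of eqs_37CP.

Definition eqs_37D : 7.-tuple (form 'rV[K]_7 2) :=
  [tuple 0; 0; 0; 0; e 1 2 + e 3 4; e 1 3; e 2 4].
Lemma eqs_37DP : lie_bracket_axioms (bracket_of eqs_37D).
Proof. prove_lie_bracket. Qed.
Definition lie_37D : lieAlgType K := lie_of eqs_37DP.

Definition eqs_37D1 : 7.-tuple (form 'rV[K]_7 2) :=
  [tuple 0; 0; 0; 0; e 1 2 - e 3 4; e 1 3 + e 2 4; e 1 4 - e 2 3].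
Lemma eqs_37D1P : lie_bracket_axioms (bracket_of eqs_37D1).
Proof. prove_lie_bracket. Qed.
Definition lie_37D1 : lieAlgType K := lie_of eqs_37D1P.

Definition algebra_of_label (l : label) : lieAlgType K :=
  match l with
  | L17 => lie_17 | L37A => lie_37A | L37B => lie_37B | L37B1 => lie_37B1
  | L37C => lie_37C | L37D => lie_37D | L37D1 => lie_37D1
  end.

End SevenAlgebras.

(* Main.v *)
(* Let D = [g, g], so that D is central.  If g is indecomposable, its center  *)
(* is D; and dim D <= 3, since the bracket factors through the exterior       *)
(* square of g / D.                                                           *)
(*                                                                            *)
(* dim D = 1: the bracket is a symplectic form on g / D, which gives 17.      *)
(*                                                                            *)
(* dim D = 2: no coclosed structure exists.  Let x, y span D, let z be their  *)
(* cross product, and let psi be the Hodge dual of phi.  If w is a component  *)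
(* of the bracket, closedness of psi at (x, z, ., ., .) says that             *)
(* w(z, .) /\ psi(x, y, ., .) vanishes.  As psi(x, y, ., .) has rank 4 and    *)
(* kernel <x, y, z>, this forces w(z, .) = 0, so that z is central; but z is  *)
(* orthogonal to D.                                                           *)
(*                                                                            *)
(* dim D = 3: the bracket is a net W of skew forms on the 4-dimensional space *)
(* g / D, with the Pfaffian as a quadratic form.  If A in W is nondegenerate, *)
(* complete it to an orthogonal basis A, B, C of W.  Then T = B A^-1 and      *)
(* S = C A^-1 anticommute and have scalar squares, and a suitable v yields a  *)
(* basis v, vT, vS, vST of g / D in which W depends on these squares only,    *)
(* up to scaling on their signs.  If the Pfaffian vanishes on W, then W has a *)
(* common kernel, which is excluded, or a common factor, which gives 37A.     *)
(* Conversely, the coclosed structures are found by making D an associative   *)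
(* plane <E_5, E_6, E_7>: if phi = e^567 + sum_j e^j /\ w_j, then d psi = 0   *)
(* means that the matrix of the products de^i /\ w_j is symmetric.            *)
(*                                                                            *)
(* The seven algebras are distinguished by dim D and, for dim D = 3, by the   *)
(* isotropic vectors and the radical of the Pfaffian.                         *)

Require Import Defs.
From HB Require Import structures.
From mathcomp Require Import all_boot all_order all_algebra.
From mathcomp Require Import fingroup perm zify ring lra.
From mathcomp Require Import boolp functions reals.

Set Implicit Arguments.
Unset Strict Implicit.
Unset Printing Implicit Defensive.
Import Order.TTheory GRing.Theory Num.Theory.
Local Open Scope ring_scope.

(** Isomorphism with an algebra of the list is turned into the existence of a [label_basis], a basis
    whose dual coframe satisfies the structure equations ([lie_isomorphic_label]).

    Let D = [g, g], which is central. A central vector outside D would span a direct summand, so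
    indecomposability puts the center inside D ([center_of_indecomposable]). Were dim D at least 4,
    a complement of D would have dimension at most 3 and its three brackets would span D; hence dim
    D is at most 3 ([dim_derived_le3]). For dim D = 1 a symplectic basis of g / D gives 17
    ([label_17_of_line]). For dim D = 2 closedness of psi makes the cross product of a basis of D
    central, hence an element of D, while it is nonzero and orthogonal to D
    ([derived_plane_center]). For dim D = 3 the components of the bracket span a net of skew forms
    on a 4-space, which the Pfaffian brings to normal form ([skew_net_normal_form],
    [label_of_derived3]).

    Conversely, adapted frames are written down for each algebra ([label_coclosed]), and
    indecomposability follows from the center lying in D with dim D equal to 1 or 3
    ([indecomposable_of_center]). Finally, 17 is singled out by dim D; on the other six, wedging
    components of the bracket is a quadratic form on the dual of D, intrinsic up to scale, whose
    qualitative properties are all different ([label_basis_unique]). *)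

Lemma linear_formE (K : fieldType) (V : lmodType K) (f : V -> K^o) : linear f ->
  [/\ f 0 = 0, forall a u, f (a *: u) = a * f u,
      forall u v, f (u + v) = f u + f v & forall u, f (- u) = - f u].
Proof.
move=> fL; have f0 : f 0 = 0.
  by have := fL (-1) 0 0; rewrite !scaleN1r addNr => ->; rewrite addNr.
have fZ a u : f (a *: u) = a * f u by have := fL a u 0; rewrite f0 !addr0.
by split=> // [u v|u]; [have := fL 1 u v; rewrite !scale1r | rewrite -scaleN1r fZ mulN1r].
Qed.

(** Reduces an identity between vectors to scalar identities, which [ring] or [field] can settle. *)
Lemma vect_ext (K : fieldType) (V : vectType K) (u v : V) :
  (forall f : V -> K^o, linear f -> f u = f v) -> u = v.
Proof.
move=> H; rewrite (coord_vbasis (memvf u)) (coord_vbasis (memvf v)).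
apply: eq_bigr => i _; congr (_ *: _).
by apply: (H (coord (vbasis fullv) i)); exact: linearP.
Qed.

(** * Brackets and structure equations *)

Section LieBracket.
Variables (K : fieldType) (g : lieAlgType K).
Implicit Types (x y z : g) (a : K).

Lemma lieDl x y z : lie_bracket (x + y) z = lie_bracket x z + lie_bracket y z.
Proof.
have := lie_bracket_linear_l (@lie_bracketP _ g) z 1 x y.
by rewrite /= !scale1r.
Qed.

Lemma lieDr x y z : lie_bracket z (x + y) = lie_bracket z x + lie_bracket z y.
Proof.
have := lie_bracket_linear_r (@lie_bracketP _ g) z 1 x y.
by rewrite /= !scale1r.
Qed.

Lemma lie0l x : lie_bracket 0 x = 0.
Proof. by apply: (addrI (lie_bracket 0 x)); rewrite -lieDl !addr0. Qed.

Lemma lie0r x : lie_bracket x 0 = 0.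
Proof. by apply: (addrI (lie_bracket x 0)); rewrite -lieDr !addr0. Qed.

Lemma lieZl a x y : lie_bracket (a *: x) y = a *: lie_bracket x y.
Proof.
have := lie_bracket_linear_l (@lie_bracketP _ g) y a x 0.
by rewrite /= !addr0 lie0l addr0.
Qed.

Lemma lieZr a x y : lie_bracket y (a *: x) = a *: lie_bracket y x.
Proof.
have := lie_bracket_linear_r (@lie_bracketP _ g) y a x 0.
by rewrite /= !addr0 lie0r addr0.
Qed.

Lemma liexx x : lie_bracket x x = 0.
Proof. exact: lie_bracket_alternating (@lie_bracketP _ g) x. Qed.

Lemma lieC x y : lie_bracket x y = - lie_bracket y x.
Proof.
apply/eqP; rewrite -addr_eq0; apply/eqP.
by have := liexx (x + y); rewrite lieDl !lieDr !liexx add0r addr0.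
Qed.

Lemma lieNl x y : lie_bracket (- x) y = - lie_bracket x y.
Proof. by rewrite -scaleN1r lieZl scaleN1r. Qed.

Lemma lieNr x y : lie_bracket x (- y) = - lie_bracket x y.
Proof. by rewrite -scaleN1r lieZr scaleN1r. Qed.

Lemma lie_suml (I : finType) (P : pred I) (F : I -> g) y :
  lie_bracket (\sum_(i | P i) F i) y = \sum_(i | P i) lie_bracket (F i) y.
Proof.
by apply: (big_morph (lie_bracket^~ y)) => [u v|]; [apply: lieDl | apply: lie0l].
Qed.

Lemma lie_sumr (I : finType) (P : pred I) (F : I -> g) y :
  lie_bracket y (\sum_(i | P i) F i) = \sum_(i | P i) lie_bracket y (F i).
Proof.
by apply: (big_morph (lie_bracket y)) => [u v|]; [apply: lieDr | apply: lie0r].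
Qed.

End LieBracket.

Section StructureBasis.
Variables (K : fieldType) (g : lieAlgType K).
Implicit Types (F : 7.-tuple g) (de : 7.-tuple (Defs.form 'rV[K]_7 2)).

Definition frame_row F x : 'rV[K]_7 := \row_i coord F i x.

Definition structure_basis de F : Prop :=
  basis_of fullv F /\
  forall x y k, coord F k (lie_bracket x y) =
    - tnth de k (pair_args (frame_row F x) (frame_row F y)).

Lemma frame_rowE F x : basis_of fullv F ->
  x = \sum_i frame_row F x 0 i *: F`_i.
Proof.
move=> bF; rewrite {1}(coord_basis bF (memvf x)).
by apply: eq_bigr => i _; rewrite mxE.
Qed.

Lemma frame_row_linear F : linear (frame_row F).
Proof. by move=> a x y; apply/rowP=> i; rewrite !mxE linearP. Qed.

(** An isomorphism f gives the preimages of the standard basis; conversely, the coordinates in a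
    structure basis define the isomorphism. *)
Lemma lie_isomorphic_structure_basis de (H : lie_bracket_axioms (bracket_of de)) :
  lie_isomorphic g (lie_of H) <-> exists F, structure_basis de F.
Proof.
split=> [[f [[f' fK f'K] fM]]|[F [bF FE]]].
  pose F : 7.-tuple g := [tuple f' (delta_mx 0 i) | i < 7].
  have f'L : linear f'.
    move=> a u v; apply: (can_inj fK); rewrite f'K.
    by rewrite linearP !f'K.
  have FiE (i : 'I_7) : F`_i = f' (delta_mx 0 i).
    by rewrite -tnth_nth tnth_mktuple.
  have fF (c : 'I_7 -> K) : f (\sum_i c i *: F`_i) = \row_i c i.
    rewrite linear_sum [RHS]row_sum_delta; apply: eq_bigr => i _.
    by rewrite linearZ /= FiE f'K mxE.
  have frF : free F.
    apply/freeP => c c0 i; have := fF c; rewrite c0 linear0.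
    by move/rowP/(_ i); rewrite !mxE.
  have xE x : x = \sum_i (f x : 'rV[K]_7) 0 i *: F`_i.
    apply: (can_inj fK); rewrite fF; apply/rowP => i; by rewrite mxE.
  have cE x i : coord F i x = (f x : 'rV[K]_7) 0 i.
    by rewrite {1}[x]xE coord_sum_free.
  exists F; split.
    rewrite basisEfree frF subvf /=; apply: leq_trans (dim_span F).
    apply: dimvS; apply/subvP => x _; rewrite [x]xE.
    by apply: memv_suml => i _; apply/memvZ/memv_span/mem_nth; rewrite size_tuple.
  move=> x y k; rewrite cE fM.
  have rE z : frame_row F z = f z by apply/rowP=> i; rewrite mxE cE.
  by rewrite !rE; transitivity (bracket_of de (f x) (f y) 0 k); rewrite ?mxE.
pose phi : g -> lie_of H := frame_row F.
have phiL : linear phi by exact: (@frame_row_linear F).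
pose lphi : {linear g -> lie_of H} :=
  HB.pack phi (GRing.isLinear.Build _ _ _ _ phi phiL).
exists lphi; split.
  exists (fun u : 'rV[K]_7 => \sum_i u 0 i *: F`_i) => [x|u].
    by rewrite /lphi /= /phi -frame_rowE.
  rewrite /lphi /= /phi; apply/rowP => i.
  by rewrite mxE coord_sum_free // (basis_free bF).
move=> x y; apply/rowP => k.
transitivity (bracket_of de (frame_row F x) (frame_row F y) 0 k); last by [].
rewrite [RHS]mxE -FE; exact: mxE.
Qed.

End StructureBasis.

Section LabelBasis.
Variables (K : fieldType) (g : lieAlgType K).
Implicit Types (F : 7.-tuple g) (x y : g) (l : label) (i j k : nat).

Definition minor2 F i j x y : K :=
  coframe F i x * coframe F j y - coframe F i y * coframe F j x.

(** The right-hand side of the k-th structure equation, with [m i j] in the place of the monomial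
    e^{ij}. Leaving [m] abstract lets the same table serve for values of 2-forms ([minor2]) and for
    structure constants ([delta_form]). *)
Definition label_form l (m : nat -> nat -> K) k : K :=
  match l, k with
  | L17, 7 => m 1%N 2%N + m 3%N 4%N + m 5%N 6%N
  | L37A, 5 => m 1%N 2%N | L37A, 6 => m 2%N 3%N | L37A, 7 => m 2%N 4%N
  | L37B, 5 => m 1%N 2%N | L37B, 6 => m 2%N 3%N | L37B, 7 => m 3%N 4%N
  | L37B1, 5 => m 1%N 2%N - m 3%N 4%N | L37B1, 6 => m 1%N 3%N + m 2%N 4%N | L37B1, 7 => m 1%N 4%N
  | L37C, 5 => m 1%N 2%N + m 3%N 4%N | L37C, 6 => m 2%N 3%N | L37C, 7 => m 2%N 4%N
  | L37D, 5 => m 1%N 2%N + m 3%N 4%N | L37D, 6 => m 1%N 3%N | L37D, 7 => m 2%N 4%N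
  | L37D1, 5 => m 1%N 2%N - m 3%N 4%N | L37D1, 6 => m 1%N 3%N + m 2%N 4%N
  | L37D1, 7 => m 1%N 4%N - m 2%N 3%N
  | _, _ => 0
  end.

Definition label_basis l F : Prop :=
  basis_of fullv F /\
  forall x y k, (0 < k < 8)%N ->
    coframe F k (lie_bracket x y) = - label_form l (fun i j => minor2 F i j x y) k.

Lemma lie_isomorphic_label l :
  lie_isomorphic g (algebra_of_label K l) <-> exists F, label_basis l F.
Proof.
suff H (de : 7.-tuple (Defs.form 'rV[K]_7 2)) : (forall F x y k, (k < 7)%N ->
    nth (0 : Defs.form _ 2) de k (pair_args (frame_row F x) (frame_row F y)) =
    label_form l (fun i j => minor2 F i j x y) k.+1) ->
    forall H : lie_bracket_axioms (bracket_of de),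
    lie_isomorphic g (lie_of H) <-> exists F, label_basis l F.
  have mE F i j x y :
      e2 i j (pair_args (frame_row F x) (frame_row F y)) = minor2 F i j x y.
    by rewrite e2E /std_coframe !mxE.
  by case: l H => H; apply: H => F x y [|[|[|[|[|[|[|k]]]]]]] //= _;
     rewrite ?(form0E, formDE, formNE, mE).
move=> E H; apply: (iff_trans (lie_isomorphic_structure_basis g H)).
split=> -[F [bF FE]]; exists F; split=> // x y k.
  case: k => // k /= k7; rewrite -E // /coframe FE.
  by rewrite (tnth_nth 0) /= inordK.
rewrite (tnth_nth (0 : Defs.form _ 2)) E ?ltn_ord // -FE; last by rewrite /= ltnS ltn_ord.
by rewrite /coframe /= inord_val.
Qed.

Lemma coframeD F i x y : coframe F i (x + y) = coframe F i x + coframe F i y.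
Proof. by rewrite /coframe linearD. Qed.

Lemma coframeN F i x : coframe F i (- x) = - coframe F i x.
Proof. by rewrite /coframe linearN. Qed.

Lemma coframeZ F i a x : coframe F i (a *: x) = a * coframe F i x.
Proof. by rewrite /coframe linearZ. Qed.

Lemma coframe0 F i : coframe F i 0 = 0.
Proof. by rewrite /coframe linear0. Qed.

(* Coframes are numbered from 1, as in the paper, but tuples from 0. *)
Lemma coframe_nth F i j : free F -> (0 < i < 8)%N -> (j < 7)%N ->
  coframe F i F`_j = (i == j.+1)%:R.
Proof.
move=> fF; case: i => // i /= i7 j7; rewrite /coframe /=.
have -> : F`_j = F`_(inord j : 'I_7) by rewrite inordK.
by rewrite coord_free // eq_sym -(inj_eq val_inj) /= !inordK // eqSS.
Qed.

Lemma coframe_sum F x : basis_of fullv F ->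
  x = coframe F 1 x *: F`_0 + coframe F 2 x *: F`_1 + coframe F 3 x *: F`_2
    + coframe F 4 x *: F`_3 + coframe F 5 x *: F`_4 + coframe F 6 x *: F`_5
    + coframe F 7 x *: F`_6.
Proof.
move=> bF; rewrite {1}(coord_basis bF (memvf x)) !big_ord_recl big_ord0 addr0 !addrA.
by rewrite /coframe; do ![congr (_ + _) | congr (_ *: _) | congr (coord F _ x)];
   apply: val_inj; rewrite /= inordK.
Qed.

Lemma coframe_inj F x y : basis_of fullv F ->
  (forall i, (0 < i < 8)%N -> coframe F i x = coframe F i y) -> x = y.
Proof.
by move=> bF H; rewrite (coframe_sum x bF) (coframe_sum y bF) !H.
Qed.

(** The expansion shows that the seven vectors span, hence form a basis by dimension, and then its
    coefficients must be the coordinates. A new frame can thus be given together with its dual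
    frame. *)
Lemma frame_of_coframe F (c : nat -> g -> K) : \dim (fullv : {vspace g}) = 7%N ->
  (forall x, x = c 1%N x *: F`_0 + c 2%N x *: F`_1 + c 3%N x *: F`_2
    + c 4%N x *: F`_3 + c 5%N x *: F`_4 + c 6%N x *: F`_5 + c 7%N x *: F`_6) ->
  basis_of fullv F /\ forall i x, (0 < i < 8)%N -> coframe F i x = c i x.
Proof.
move=> d7 H; have bF : basis_of fullv F.
  rewrite basisEdim size_tuple d7 leqnn andbT; apply/subvP => x _.
  by rewrite (H x) !memvD // memvZ // memv_span // mem_nth // size_tuple.
split=> // i x iP; have fF := basis_free bF.
rewrite {1}(H x) !coframeD !coframeZ !coframe_nth //.
by case: i iP => [|[|[|[|[|[|[|[|i]]]]]]]] //= _;
   rewrite !mulr0 ?mulr1 ?addr0 ?add0r.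
Qed.

End LabelBasis.

(** * The Hodge dual of a G2-form *)

Section HodgeStar.
Variables (K : fieldType) (V : vectType K).

(** The product of Kronecker symbols is nonzero for only one function i, the one with i (s p) = J p
    for all p. *)
Lemma sum_ffun_delta (k n : nat) (J : 'I_k -> 'I_n) (s : 'S_k)
    (G : {ffun 'I_k -> 'I_n} -> K) :
  \sum_(i : {ffun 'I_k -> 'I_n}) (\prod_p (J p == i (s p))%:R) * G i =
  G [ffun p => J (s^-1%g p)].
Proof.
rewrite (bigD1 [ffun p => J (s^-1%g p)]) //= big1 ?mul1r => [|p _].
  rewrite big1 ?addr0 // => i iN.
  suff [p pN] : exists p, J p != i (s p).
    by rewrite (bigD1 p) //= (negbTE pN) !mul0r.
  apply/existsP; rewrite -negb_forall; apply: contra iN => /forallP H.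
  by apply/eqP/ffunP => p; rewrite ffunE (eqP (H _)) permKV.
by rewrite ffunE permK eqxx.
Qed.

(** Expanding the determinant of the monomial, each permutation s selects one multi-index. Its sign
    cancels the sign by which s changes the volume form, so that k! equal terms cancel the factor
    1/k!. *)
Lemma hodge_star_monomial (k l : nat) (E : (k + l).-tuple V)
    (theta : nat -> V -> K) (i : k.-tuple nat) (J : 'I_k -> 'I_(k + l)) y :
  (k`!%:R != 0 :> K) -> free E -> (forall p, theta (tnth i p) =1 coord E (J p)) ->
  hodge_star E (monomial theta i) y =
  volume_form E (cat_args (fun p => tnth E (J p)) y).
Proof.
move=> k0 fE tE; rewrite /hodge_star.
pose G (j : {ffun 'I_k -> 'I_(k + l)}) :=
  volume_form E (cat_args (fun p => tnth E (j p)) y).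
have GE (s : 'S_k) : G [ffun p => J (s^-1%g p)] =
    (-1) ^+ s * volume_form E (cat_args (fun p => tnth E (J p)) y).
  pose L (j : 'I_k -> 'I_(k + l)) : 'M_(k + l, k) :=
    \matrix_(p, q) coord E p (tnth E (j q)).
  pose Y : 'M_(k + l, l) := \matrix_(p, q) coord E p (y q).
  have vE j : volume_form E (cat_args (fun p => tnth E (j p)) y)
      = \det (row_mx (L j) Y).
    congr (\det _); apply/matrixP => p q; rewrite !mxE /cat_args.
    by case: splitP => r _; rewrite !mxE.
  rewrite /G !vE.
  (* Permuting the first k arguments multiplies the matrix of the volume form by a block-diagonal
     permutation matrix, of determinant the sign of s. *)
  have -> : L [ffun p => J (s^-1%g p)] = L J *m perm_mx s.
    by rewrite -{2}[s]invgK -col_permE; apply/matrixP=> p q; rewrite !mxE ffunE.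
  have -> : row_mx (L J *m perm_mx s) Y
      = row_mx (L J) Y *m block_mx (perm_mx s) 0 0 1%:M.
    by rewrite mul_row_block !mulmx0 mulmx1 addr0 add0r.
  by rewrite det_mulmx det_ublock det1 mulr1 det_perm mulrC.
under eq_bigr => j _.
  rewrite /monomial -[volume_form _ _]/(G j) /determinant mulr_suml.
  under eq_bigr => s _.
    under eq_bigr => p _ do rewrite mxE tE (tnth_nth 0) coord_free //.
    rewrite -mulrA; over.
  over.
rewrite exchange_big /=.
under eq_bigr => s _.
  rewrite -mulr_sumr.
  rewrite [X in _ * X](_ : _ = G [ffun p => J (s^-1%g p)]);
    last (rewrite -sum_ffun_delta; apply: eq_bigr => j _; congr (_ * _);
      by apply: eq_bigr => p _; rewrite eq_sym).
  rewrite GE mulrA -expr2 sqrr_sign mul1r; over.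
by rewrite big_const iter_addr_0 card_Sn -(mulr_natl (volume_form _ _)) mulKf.
Qed.

Lemma hodge_starD k l (E : (k + l).-tuple V) (a b : Defs.form V k) :
  hodge_star E (a + b) = hodge_star E a + hodge_star E b.
Proof.
apply/funext => y; transitivity (hodge_star E a y + hodge_star E b y); last by [].
rewrite /hodge_star -mulrDr; congr (_ * _); rewrite -big_split.
by apply: eq_bigr => i _; exact: mulrDl.
Qed.

Lemma hodge_starN k l (E : (k + l).-tuple V) (a : Defs.form V k) :
  hodge_star E (- a) = - hodge_star E a.
Proof.
apply/funext => y; transitivity (- hodge_star E a y); last by [].
rewrite /hodge_star -mulrN; congr (_ * _); rewrite -sumrN.
by apply: eq_bigr => i _; exact: mulNr.
Qed.

Lemma det_delta_col n (f : nat -> nat -> K) j : (j < n.+1)%N ->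
  (forall p, f p 0%N = (p == j)%:R) ->
  \det (\matrix_(p < n.+1, q < n.+1) f p q) =
  (-1) ^+ j * \det (\matrix_(p < n, q < n) f (bump j p) q.+1).
Proof.
move=> jn f0; rewrite (expand_det_col _ 0) (bigD1 (Ordinal jn)) //= big1.
  rewrite mxE f0 eqxx mul1r addr0 /cofactor addn0; congr (_ * \det _).
  by apply/matrixP => p q; rewrite !mxE.
move=> i iN; rewrite mxE f0 (_ : (i == j :> nat) = false) ?mul0r //.
by apply/negbTE; apply: contra iN => /eqP ij; apply/eqP/val_inj.
Qed.

(** The first three columns are unit vectors, so three column expansions leave a 4 x 4 minor. After
    deletion of row a, row b sits in position b - 1; after both deletions, row c sits in position c
    - 2. *)
Lemma volume_form_frame3 (E : 7.-tuple V) (a b c : nat) (y : 'I_4 -> V) :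
  free E -> (a < b < c)%N -> (c < 7)%N ->
  volume_form E (cat_args (k := 3) (l := 4)
    (fun p => tnth E (inord (tnth [tuple a; b; c] p))) y) =
  (-1) ^+ (a + b.-1 + c.-2) * \det (\matrix_(p < 4, q < 4)
    coord E (inord (bump a (bump b.-1 (bump c.-2 p)))) (y q)).
Proof.
move=> fE /andP [ab bc] c7.
pose f (p q : nat) : K := match q with
  | 0 => (p == a)%:R | 1 => (p == b)%:R | 2 => (p == c)%:R
  | q'.+3 => coord E (inord p) (y (inord q')) end.
have -> : volume_form E (cat_args (k := 3) (l := 4)
    (fun p => tnth E (inord (tnth [tuple a; b; c] p))) y) =
    \det (\matrix_(p < 7, q < 7) f p q).
  congr (\det _); apply/matrixP => p q; rewrite !mxE /cat_args.
  case: splitP => r ->.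
    rewrite (tnth_nth 0) coord_free //.
    have a7 : (a < 7)%N by lia.
    have b7 : (b < 7)%N by lia.
    have H u : (u < 7)%N -> (p == inord u) = (p == u :> nat).
      by move=> u7; rewrite -(inj_eq val_inj) /= inordK.
    by case: r => -[|[|[|r]]] //= Hr; rewrite (tnth_nth 0%N) /=;
      congr (_ %:R); apply: (congr1 nat_of_bool); rewrite eq_sym; exact: H.
  by rewrite -[(3 + r)%N]/(r.+3) /f !inord_val.
rewrite (det_delta_col (j := a)) //; last by lia.
rewrite (@det_delta_col _ (fun p q => f (bump a p) q.+1) b.-1) /=; [| by lia |].
  rewrite (@det_delta_col _ (fun p q => f (bump a (bump b.-1 p)) q.+2) c.-2) /=; [| by lia |].
    rewrite !mulrA -!exprD; congr (_ * \det _); apply/matrixP => p q.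
    by rewrite !mxE inord_val.
  by move=> p; congr (_%:R); rewrite /bump; lia.
by move=> p; congr (_%:R); rewrite /bump; lia.
Qed.

End HodgeStar.

Section G2Dual.
Variables (R : realType) (g : lieAlgType R).
Implicit Types E : 7.-tuple g.

Definition G2_dual E : Defs.form g 4 :=
  let e i j k l := monomial (coframe E) [tuple i; j; k; l] in
  e 1%N 2%N 3%N 4%N + e 1%N 2%N 5%N 6%N + e 1%N 3%N 6%N 7%N + e 1%N 4%N 5%N 7%N + e 2%N 3%N 5%N 7%N - e 2%N 4%N 6%N 7%N
  + e 3%N 4%N 5%N 6%N.

Lemma hodge_star_G2_form E : basis_of fullv E ->
  hodge_star (k := 3) (l := 4) E (G2_form E) = G2_dual E.
Proof.
move=> bE; have fE := basis_free bE.
(* The indices a, b, c count frame vectors from 0, whereas p, q, r, s count coframe elements from 1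
   and are the complementary indices. *)
have H (a b c p q r s : nat) : (a < b < c)%N -> (c < 7)%N ->
    (forall i : 'I_4, bump a (bump b.-1 (bump c.-2 i)) =
      (tnth [tuple p; q; r; s] i).-1) ->
    hodge_star (k := 3) (l := 4) E
      (monomial (coframe E) [tuple a.+1; b.+1; c.+1]) =
    fun y => (-1) ^+ (a + b.-1 + c.-2) * monomial (coframe E) [tuple p; q; r; s] y.
  move=> abc c7 Hb; apply/funext => y.
  rewrite (@hodge_star_monomial _ _ 3 4 E _ _
    (fun p => inord (tnth [tuple a; b; c] p))) //.
  - rewrite volume_form_frame3 //; congr (_ * \det _); apply/matrixP => i j.
    by rewrite !mxE Hb.
  - by rewrite pnatr_eq0.
  by move=> [[|[|[|i]]] Hi].
rewrite /G2_form !(hodge_starD, hodge_starN).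
rewrite (H 0 1 6 3 4 5 6)%N //; last by move=> [[|[|[|[|i]]]] Hi].
rewrite (H 2 3 6 1 2 5 6)%N //; last by move=> [[|[|[|[|i]]]] Hi].
rewrite (H 4 5 6 1 2 3 4)%N //; last by move=> [[|[|[|[|i]]]] Hi].
rewrite (H 0 2 4 2 4 6 7)%N //; last by move=> [[|[|[|[|i]]]] Hi].
rewrite (H 0 3 5 2 3 5 7)%N //; last by move=> [[|[|[|[|i]]]] Hi].
rewrite (H 1 2 5 1 4 5 7)%N //; last by move=> [[|[|[|[|i]]]] Hi].
rewrite (H 1 3 4 1 3 6 7)%N //; last by move=> [[|[|[|[|i]]]] Hi].
apply/funext => y.
rewrite /G2_dual !fctE /=; ring.
Qed.


End G2Dual.

(** * Explicit values of 4-forms and of their differentials *)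

Section ExplicitForms.
Variable K : fieldType.

Lemma det_row0 n (f : nat -> nat -> K) :
  \det (\matrix_(p < n.+1, q < n.+1) f p q) =
  \sum_(j < n.+1)
    f 0%N j * ((-1) ^+ j * \det (\matrix_(p < n, q < n) f p.+1 (bump j q))).
Proof.
rewrite (expand_det_row _ 0); apply: eq_bigr => j _.
rewrite mxE /cofactor add0n; congr (_ * (_ * \det _)).
by apply/matrixP => p q; rewrite !mxE.
Qed.

(** Laplace expansion along the first two rows. *)
Definition det4 (f : nat -> nat -> K) : K :=
  let m a b := f 0%N a * f 1%N b - f 0%N b * f 1%N a in
  let n a b := f 2%N a * f 3%N b - f 2%N b * f 3%N a in
  m 0%N 1%N * n 2%N 3%N - m 0%N 2%N * n 1%N 3%N + m 0%N 3%N * n 1%N 2%N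
  + m 1%N 2%N * n 0%N 3%N - m 1%N 3%N * n 0%N 2%N + m 2%N 3%N * n 0%N 1%N.

Lemma det4E (f : nat -> nat -> K) :
  \det (\matrix_(p < 4, q < 4) f p q) = det4 f.
Proof.
rewrite det_row0 !big_ord_recl big_ord0 /=.
rewrite !(@det_row0 2 (fun p q => f p.+1 (bump _ q))).
rewrite !big_ord_recl !big_ord0 /=.
rewrite !(@det_row0 1 (fun p q => f p.+2 (bump _ (bump _ q)))).
rewrite !big_ord_recl !big_ord0 /=.
rewrite !det_mx11 !mxE /= /bump /=.
rewrite !add0n /= /det4 /=.
ring.
Qed.

Variable g : lieAlgType K.

Definition args4 (T : Type) (x y z t : T) : 'I_4 -> T :=
  fun m => nth x [:: x; y; z; t] m.

Definition args5 (T : Type) (x y z t u : T) : 'I_5 -> T :=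
  fun m => nth x [:: x; y; z; t; u] m.

Lemma args5E (T : Type) (x : 'I_5 -> T) :
  x = args5 (x (inord 0)) (x (inord 1)) (x (inord 2)) (x (inord 3)) (x (inord 4)).
Proof.
apply/funext => -[[|[|[|[|[|i]]]]] Hi] //; congr x; apply: val_inj;
by rewrite /= inordK.
Qed.

Lemma ce_diff4E (a : Defs.form g 4) (x y z t u : g) (br := @lie_bracket _ g) :
  ce_diff a (args5 x y z t u) =
  - a (args4 (br x y) z t u) + a (args4 (br x z) y t u)
  - a (args4 (br x t) y z u) + a (args4 (br x u) y z t)
  - a (args4 (br y z) x t u) + a (args4 (br y t) x z u)
  - a (args4 (br y u) x z t) - a (args4 (br z t) x y u)
  + a (args4 (br z u) x y t) - a (args4 (br t u) x y z).
Proof.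
rewrite /ce_diff.
have H (s : 'I_5) (j : 'I_4) p q r :
  (args5 x y z t u (lift s (lift j ord0)) = p) ->
  (args5 x y z t u (lift s (lift j (inord 1))) = q) ->
  (args5 x y z t u (lift s (lift j (inord 2))) = r) ->
  (fun m : 'I_4 => match unlift ord0 m with
      | None => lie_bracket (args5 x y z t u s) (args5 x y z t u (lift s j))
      | Some l => args5 x y z t u (lift s (lift j l)) end) =
  args4 (lie_bracket (args5 x y z t u s) (args5 x y z t u (lift s j))) p q r.
  move=> <- <- <-; apply/funext => m; case: unliftP => [k ->|->] //.
  case: k => -[|[|[|k]]] Hk //; rewrite /args4 /=.
  - by congr (args5 _ _ _ _ _ (lift _ (lift _ _))); apply: val_inj; rewrite /= inordK.
  - by congr (args5 _ _ _ _ _ (lift _ (lift _ _))); apply: val_inj; rewrite /= inordK.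
under eq_bigr => s _.
  under eq_bigr => j _ do rewrite (H s j _ _ _ erefl erefl erefl).
  rewrite big_mkcond /= 4!big_ord_recl big_ord0 /=; over.
rewrite 5!big_ord_recl big_ord0 /args5 /= /bump /= !inordK //= -/br.
ring.
Qed.

End ExplicitForms.

Section G2DualExplicit.
Variables (R : realType) (g : lieAlgType R).
Implicit Types (E : 7.-tuple g) (x y z t : g).

Lemma monomial4E (V : vectType R) (theta : nat -> V -> R) (i j k l : nat)
    (x y z t : V) (m := fun a b u v => theta a u * theta b v - theta a v * theta b u) :
  monomial theta [tuple i; j; k; l] (args4 x y z t) =
  m i j x y * m k l z t - m i j x z * m k l y t + m i j x t * m k l y z
  + m i j y z * m k l x t - m i j y t * m k l x z + m i j z t * m k l x y.
Proof.
transitivity (det4 (fun p q => theta (nth 0%N [:: i; j; k; l] p)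
                                     (nth x [:: x; y; z; t] q))).
  rewrite -det4E; congr (\det _); apply/matrixP => p q.
  by rewrite !mxE (tnth_nth 0%N).
rewrite /det4 /m /=; ring.
Qed.

(* phi = e^567 + e^5 /\ omega5 + e^6 /\ omega6 + e^7 /\ omega7 *)
Definition omega5 E x y := minor2 E 1 3 x y - minor2 E 2 4 x y.
Definition omega6 E x y := - (minor2 E 1 4 x y + minor2 E 2 3 x y).
Definition omega7 E x y := minor2 E 1 2 x y + minor2 E 3 4 x y.

Definition wedge12 (a : g -> R) (w : g -> g -> R) x y z : R :=
  a x * w y z - a y * w x z + a z * w x y.

Definition wedge22 (v w : g -> g -> R) x y z t : R :=
  v x y * w z t - v x z * w y t + v x t * w y z
  + v y z * w x t - v y t * w x z + v z t * w x y.

(** One has psi = e^1234 + e^56 /\ omega7 + e^67 /\ omega5 + e^75 /\ omega6, and contraction with a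
    vector p in the span of E_5, E_6, E_7 kills e^1234 and the three omegas. *)
Lemma G2_dual_vertical E p x y z (c := coframe E) :
  c 1%N p = 0 -> c 2%N p = 0 -> c 3%N p = 0 -> c 4%N p = 0 ->
  G2_dual E (args4 p x y z) =
  c 5%N p * (wedge12 (c 6%N) (omega7 E) x y z - wedge12 (c 7%N) (omega6 E) x y z)
  + c 6%N p * (wedge12 (c 7%N) (omega5 E) x y z - wedge12 (c 5%N) (omega7 E) x y z)
  + c 7%N p * (wedge12 (c 5%N) (omega6 E) x y z - wedge12 (c 6%N) (omega5 E) x y z).
Proof.
move=> p1 p2 p3 p4.
rewrite /G2_dual !fctE /= !monomial4E -/c p1 p2 p3 p4.
rewrite /wedge12 /omega5 /omega6 /omega7 /minor2 -/c; ring.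
Qed.

(** Here [a5], [a6], [a7] are - de^5, - de^6, - de^7. Differentiating psi and collecting e^5, e^6
    and e^7 leaves as coefficients the differences of the products de^i /\ omega_j and de^j /\
    omega_i. *)
Lemma G2_dual_closed E (a5 a6 a7 : g -> g -> R) (c := coframe E) :
  (forall x y, c 1%N (lie_bracket x y) = 0) ->
  (forall x y, c 2%N (lie_bracket x y) = 0) ->
  (forall x y, c 3%N (lie_bracket x y) = 0) ->
  (forall x y, c 4%N (lie_bracket x y) = 0) ->
  (forall x y, c 5%N (lie_bracket x y) = a5 x y) ->
  (forall x y, c 6%N (lie_bracket x y) = a6 x y) ->
  (forall x y, c 7%N (lie_bracket x y) = a7 x y) ->
  (forall x y z t, wedge22 a5 (omega6 E) x y z t = wedge22 a6 (omega5 E) x y z t) ->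
  (forall x y z t, wedge22 a6 (omega7 E) x y z t = wedge22 a7 (omega6 E) x y z t) ->
  (forall x y z t, wedge22 a7 (omega5 E) x y z t = wedge22 a5 (omega7 E) x y z t) ->
  ce_diff (G2_dual E) = 0.
Proof.
move=> c1 c2 c3 c4 c5 c6 c7 H56 H67 H75; apply/funext => v.
rewrite (args5E v); move: (v _) (v _) (v _) (v _) (v _) => u t z y x.
rewrite ce_diff4E !G2_dual_vertical // -/c !(c5, c6, c7).
(* [W a w] is the value of e^a /\ w, for w a 4-form. *)
transitivity (
  let W a (w : g -> g -> g -> g -> R) := c a x * w y z t u - c a y * w x z t u
    + c a z * w x y t u - c a t * w x y z u + c a u * w x y z t in
  - W 5%N (fun x y z t => wedge22 a7 (omega6 E) x y z t - wedge22 a6 (omega7 E) x y z t)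
  - W 6%N (fun x y z t => wedge22 a5 (omega7 E) x y z t - wedge22 a7 (omega5 E) x y z t)
  - W 7%N (fun x y z t => wedge22 a6 (omega5 E) x y z t - wedge22 a5 (omega6 E) x y z t)).
  by rewrite /wedge22 /wedge12 /=; ring.
rewrite /= !(H56, H67, H75) !subrr !mulr0 !subr0 !addr0 ?subr0 ?oppr0 //.
Qed.

Lemma carries_coclosed E : basis_of fullv E -> ce_diff (G2_dual E) = 0 ->
  carries_coclosed_G2_structure g.
Proof.
move=> bE dE; exists (G2_form E); first by exists E.
by exists E => //; rewrite hodge_star_G2_form.
Qed.

End G2DualExplicit.

(** * Coclosed structures on the seven algebras *)

Section LabelCoclosed.
Variables (R : realType) (g : lieAlgType R).
Implicit Types (E F : 7.-tuple g) (x y : g).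

Ltac expand_frame bF f :=
  let x := fresh "x" in let h := fresh "h" in let hL := fresh "hL" in
  let hZ := fresh "hZ" in let hD := fresh "hD" in let hN := fresh "hN" in
  move=> x; rewrite {1}(coframe_sum x bF); apply: vect_ext => h hL;
  have [_ hZ hD hN] := linear_formE hL; rewrite /f /= !(hD, hZ, hN); ring.

Ltac check_forms f FE :=
  rewrite /f /= /wedge22; split; split=> *; rewrite !FE //= ?oppr0 // /minor2; ring.

(* Apart from 17, the new coframe is chosen so that the products              *)
(* de^i /\ omega_j (i, j = 5, 6, 7) form a symmetric matrix.                  *)
Lemma label_coclosed (l : label) F : label_basis l F ->
  carries_coclosed_G2_structure g.
Proof.
move=> [bF FE].
have d7 := size_basis bF.
have closed_ext E (c : nat -> g -> R) :
  (forall x, x = c 1%N x *: E`_0 + c 2%N x *: E`_1 + c 3%N x *: E`_2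
    + c 4%N x *: E`_3 + c 5%N x *: E`_4 + c 6%N x *: E`_5 + c 7%N x *: E`_6) ->
  (let m i j x y := c i x * c j y - c i y * c j x in
   let w5 x y := m 1%N 3%N x y - m 2%N 4%N x y in
   let w6 x y := - (m 1%N 4%N x y + m 2%N 3%N x y) in
   let w7 x y := m 1%N 2%N x y + m 3%N 4%N x y in
   let a i x y := c i (lie_bracket x y) in
    [/\ forall x y, a 1%N x y = 0, forall x y, a 2%N x y = 0,
    forall x y, a 3%N x y = 0 & forall x y, a 4%N x y = 0] /\
   [/\ forall x y z t, wedge22 (a 5%N) w6 x y z t = wedge22 (a 6%N) w5 x y z t,
       forall x y z t, wedge22 (a 6%N) w7 x y z t = wedge22 (a 7%N) w6 x y z t &
       forall x y z t, wedge22 (a 7%N) w5 x y z t = wedge22 (a 5%N) w7 x y z t]) ->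
  carries_coclosed_G2_structure g.
- move=> H /= [[c1 c2 c3 c4] [H56 H67 H75]].
  have [bE cE] := frame_of_coframe d7 H.
  apply: (carries_coclosed bE).
  apply: (G2_dual_closed (a5 := fun x y => c 5%N (lie_bracket x y))
    (a6 := fun x y => c 6%N (lie_bracket x y))
    (a7 := fun x y => c 7%N (lie_bracket x y))) => //;
    try (by move=> x y; rewrite cE).
  + by move=> x y z t; move: (H56 x y z t);
      rewrite /wedge22 /omega5 /omega6 /minor2 !cE.
  + by move=> x y z t; move: (H67 x y z t);
      rewrite /wedge22 /omega7 /omega6 /minor2 !cE.
  + by move=> x y z t; move: (H75 x y z t);
      rewrite /wedge22 /omega5 /omega7 /minor2 !cE.
pose f := coframe F.
case: l FE => FE.
(* For 17 the given frame is already adapted: d psi is, up to sign, (e^136 + e^145 + e^235 - e^246)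
   /\ (e^12 + e^34 + e^56), and each of 12, 34, 56 meets each of the four triples. *)
- apply: (carries_coclosed bF); apply/funext => v.
  rewrite (args5E v); move: (v _) (v _) (v _) (v _) (v _) => u t z y x.
  rewrite ce_diff4E !G2_dual_vertical ?FE //=; rewrite ?oppr0 //.
  rewrite -[RHS]/(0 : R) /wedge12 /omega5 /omega6 /omega7 /minor2; ring.
- pose E : 7.-tuple g := [tuple F`_0; F`_1; F`_2; F`_3; F`_6; F`_5; F`_4].
  apply: (@closed_ext E (fun i => nth (f 0%N)
    [:: f 0; f 1; f 2; f 3; f 4; f 7; f 6; f 5]%N i)).
    by expand_frame bF f.
  by check_forms f FE.
(* The form e^12 - e^34 has zero product with all three omegas, so e^5 - e^7 is used as the new
   fifth covector; the other two products are then diagonal. *)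
- pose E : 7.-tuple g :=
    [tuple F`_0; F`_1; F`_2; F`_3; - F`_6; F`_5; F`_4 + F`_6].
  apply: (@closed_ext E (fun i x => nth 0
    [:: 0; f 1%N x; f 2%N x; f 3%N x; f 4%N x; f 5%N x - f 7%N x; f 6%N x; f 5%N x] i)).
    by expand_frame bF f.
  by check_forms f FE.
- pose E : 7.-tuple g := [tuple F`_0; F`_1; F`_2; F`_3; F`_4; F`_6; F`_5].
  apply: (@closed_ext E (fun i => nth (f 0%N)
    [:: f 0; f 1; f 2; f 3; f 4; f 5; f 7; f 6]%N i)).
    by expand_frame bF f.
  by check_forms f FE.
- pose E : 7.-tuple g := [tuple F`_0; F`_1; F`_2; F`_3; F`_6; F`_5; F`_4].
  apply: (@closed_ext E (fun i => nth (f 0%N)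
    [:: f 0; f 1; f 2; f 3; f 4; f 7; f 6; f 5]%N i)).
    by expand_frame bF f.
  by check_forms f FE.
(* The form e^13 + e^24 has zero product with all three omegas, so e^6 + e^7 is used as the new
   sixth covector. *)
- pose E : 7.-tuple g :=
    [tuple F`_0; F`_1; F`_2; F`_3; F`_5 - F`_6; F`_6; F`_4].
  apply: (@closed_ext E (fun i x => nth 0
    [:: 0; f 1%N x; f 2%N x; f 3%N x; f 4%N x; f 6%N x; f 6%N x + f 7%N x; f 5%N x] i)).
    by expand_frame bF f.
  by check_forms f FE.
- apply: (@closed_ext F f).
    by expand_frame bF f.
  by check_forms f FE.
Qed.
End LabelCoclosed.

(** * Derived algebra and decomposability *)

Section Derived.
Variables (K : fieldType) (g : lieAlgType K).
Implicit Types (x y z : g) (U I J : {vspace g}).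

Definition lie_derived : {vspace g} :=
  <<[seq lie_bracket u v | u <- vbasis (@fullv K g), v <- vbasis (@fullv K g)]>>.

Lemma lie_derived_min U : (forall x y, lie_bracket x y \in U) ->
  (lie_derived <= U)%VS.
Proof. by move=> H; apply/span_subvP => _ /allpairsP [p [_ _ ->]]. Qed.

Lemma mem_lie_derived x y : lie_bracket x y \in lie_derived.
Proof.
rewrite (coord_vbasis (memvf x)) lie_suml memv_suml // => i _.
rewrite (coord_vbasis (memvf y)) lie_sumr memv_suml // => j _.
rewrite lieZl lieZr !memvZ // memv_span //; apply/allpairsP.
by exists ((vbasis fullv)`_i, (vbasis fullv)`_j);
   rewrite !mem_nth ?size_tuple.
Qed.

Definition center_in_derived : Prop :=
  forall z, (forall x, lie_bracket x z = 0) -> z \in lie_derived.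

(** Complementary ideals commute. If I is abelian, it is therefore central, hence inside D; and all
    brackets come from J, so D lies in J. Thus I is contained in the intersection of I and J. *)
Lemma lie_ideal_abelian I J : center_in_derived ->
  lie_ideal I -> lie_ideal J -> (I + J)%VS = fullv -> (I :&: J)%VS = 0%VS ->
  (forall x y, x \in I -> y \in I -> lie_bracket x y = 0) -> I = 0%VS.
Proof.
move=> cen idI idJ IJ IJ0 abI.
have comm x y : x \in I -> y \in J -> lie_bracket x y = 0.
  move=> xI yJ; apply/eqP; rewrite -memv0 -IJ0 memv_cap idJ // andbT.
  by rewrite lieC memvN idI.
have dec x : exists2 u, u \in I & exists2 v, v \in J & x = u + v.
  by apply/memv_addP; rewrite IJ memvf.
have ID : (I <= lie_derived)%VS.
  apply/subvP => x xI; apply: cen => y; have [u uI [v vJ ->]] := dec y.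
  by rewrite lieDl abI // add0r lieC comm // oppr0.
have DJ : (lie_derived <= J)%VS.
  apply: lie_derived_min => x y.
  have [u uI [v vJ ->]] := dec x; have [u' uI' [v' vJ' ->]] := dec y.
  rewrite lieDl !lieDr abI // comm // (lieC v) comm // oppr0 !add0r.
  exact: idJ.
by apply/eqP; rewrite -subv0 -IJ0 subv_cap subvv (subv_trans ID).
Qed.

Lemma nonabelian_pair I :
  ~ (forall x y, x \in I -> y \in I -> lie_bracket x y = 0) ->
  exists x y, [/\ x \in I, y \in I & lie_bracket x y != 0].
Proof.
move=> H; apply: contrapT => N; apply: H => x y xI yI.
by apply/eqP/negPn/negP => xy; apply: N; exists x, y.
Qed.

Lemma lie_derived_central : (forall x y z, lie_bracket x (lie_bracket y z) = 0) ->
  forall z, z \in lie_derived -> forall x, lie_bracket x z = 0.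
Proof.
move=> nil z zD x; pose X := [seq lie_bracket u v | u <- vbasis (@fullv K g), v <- vbasis (@fullv K g)].
rewrite (@coord_span _ _ _ (in_tuple X) z zD) lie_sumr big1 // => i _.
have /allpairsP [p [_ _ ->]] := mem_nth 0 (ltn_ord i).
by rewrite lieZr nil scaler0.
Qed.

(** In a decomposition neither ideal is abelian, by [lie_ideal_abelian], so D contains nonzero p =
    [x, x'] in I and q = [y, y'] in J, which are independent; this excludes dimension 1. If dim D =
    3, then x, x', y, y' span a complement of D, so all brackets lie in the plane spanned by p and
    q, a contradiction. *)
Lemma indecomposable_of_center : \dim (@fullv K g) = 7%N ->
  (forall x y z, lie_bracket x (lie_bracket y z) = 0) -> center_in_derived ->
  (\dim lie_derived = 1%N \/ \dim lie_derived = 3%N) -> indecomposable g.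
Proof.
move=> d7 nil cen dD [I [J [idI idJ I0 J0 [IJ IJ0]]]].
have cenD := lie_derived_central nil.
have comm x y : x \in I -> y \in J -> lie_bracket x y = 0.
  move=> xI yJ; apply/eqP; rewrite -memv0 -IJ0 memv_cap idJ // andbT.
  by rewrite lieC memvN idI.
have commC x y : x \in I -> y \in J -> lie_bracket y x = 0.
  by move=> xI yJ; rewrite lieC comm // oppr0.
have [x [x' [xI x'I p0]]] : exists x y, [/\ x \in I, y \in I & lie_bracket x y != 0].
  by apply: nonabelian_pair => abI; move/eqP: I0; apply; exact: (@lie_ideal_abelian I J).
have [y [y' [yJ y'J q0]]] : exists x y, [/\ x \in J, y \in J & lie_bracket x y != 0].
  apply: nonabelian_pair => abJ; move/eqP: J0; apply.
  have JI : (J + I)%VS = fullv by rewrite addvC.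
  have JI0 : (J :&: I)%VS = 0%VS by rewrite capvC.
  exact: (lie_ideal_abelian cen idJ idI JI JI0 abJ).
set p := lie_bracket x x' in p0; set q := lie_bracket y y' in q0.
have pI : p \in I by apply: idI.
have qJ : q \in J by apply: idJ.
have pD : p \in lie_derived := mem_lie_derived _ _.
have qD : q \in lie_derived := mem_lie_derived _ _.
have pqD : (<<[:: p; q]>> <= lie_derived)%VS.
  by apply/span_subvP => v; rewrite !inE => /orP [] /eqP ->.
have dpq : \dim <<[:: p; q]>> = 2%N.
  apply/eqP; change (free [:: p; q]).
  rewrite free_cons seq1_free q0 andbT span_seq1; apply: contra p0 => pq.
  rewrite -memv0 -IJ0 memv_cap pI /=; apply: subvP pq.
  by rewrite -memvE.
have d3 : \dim lie_derived = 3%N.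
  by case: dD => // d1; have := dimvS pqD; rewrite dpq d1.
(* Bracketing a combination of these vectors with each of them isolates one coefficient, up to sign;
   since D is central, a combination in D has zero coefficients. *)
pose X := [tuple x; x'; y; y'].
have brX (a b c d : K) (v := a *: x + b *: x' + c *: y + d *: y') :
    [/\ lie_bracket x v = b *: p, lie_bracket x' v = - (a *: p),
        lie_bracket y v = d *: q & lie_bracket y' v = - (c *: q)].
  rewrite /v !lieDr !lieZr !liexx.
  rewrite (comm x y) // (comm x y') // (comm x' y) // (comm x' y') //.
  rewrite (commC x y) // (commC x y') // (commC x' y) // (commC x' y') //.
  rewrite !scaler0 !addr0 !add0r.
  by rewrite /p /q (lieC x') (lieC y') !scalerN.
have sumX (k : 'I_4 -> K) : \sum_i k i *: X`_i =
    k ord0 *: x + k (inord 1) *: x' + k (inord 2) *: y + k (inord 3) *: y'.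
  rewrite !big_ord_recl big_ord0 addr0 !addrA /=.
  by do ![congr (_ + _) | congr (_ *: _) | congr (k _)];
     apply: val_inj; rewrite /= inordK.
have indX (k : 'I_4 -> K) : \sum_i k i *: X`_i \in lie_derived -> forall i, k i = 0.
  rewrite sumX => kD.
  have [/eqP + /eqP + /eqP + /eqP] := brX (k ord0) (k (inord 1)) (k (inord 2)) (k (inord 3)).
  rewrite !cenD // ![0 == _]eq_sym !oppr_eq0 !scaler_eq0 (negbTE p0) (negbTE q0).
  rewrite !orbF => /eqP k1 /eqP k0 /eqP k3 /eqP k2 [[|[|[|[|i]]]] Hi] //.
  - by rewrite -[RHS]k0; congr k; apply: val_inj.
  - by rewrite -[RHS]k1; congr k; apply: val_inj; rewrite /= inordK.
  - by rewrite -[RHS]k2; congr k; apply: val_inj; rewrite /= inordK.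
  - by rewrite -[RHS]k3; congr k; apply: val_inj; rewrite /= inordK.
have fX : free X.
  by apply/freeP => k k0; apply: indX; rewrite k0 mem0v.
have XD : (<<X>> :&: lie_derived)%VS = 0%VS.
  apply/eqP; rewrite -subv0; apply/subvP => v; rewrite memv_cap => /andP [vX vD].
  rewrite (coord_span vX) big1 ?mem0v // => i _.
  rewrite (indX (fun i => coord X i v)) ?scale0r //.
  by rewrite -(coord_span vX).
have full : (<<X>> + lie_derived)%VS = fullv.
  apply/eqP; rewrite eqEdim subvf d7.
  by rewrite (dimv_disjoint_sum XD) d3 (eqP (fX : _ == _)).
have := d3; apply/eqP; rewrite neq_ltn; apply/orP; left.
apply: (@leq_ltn_trans 2) => //; rewrite -dpq; apply: dimvS.
apply: lie_derived_min => u v.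
have dec w : exists2 t, t \in <<X>>%VS & exists2 d, d \in lie_derived & w = t + d.
  by apply/memv_addP; rewrite full memvf.
have [t tX [d dD' ->]] := dec u; have [t' t'X [d' dD'' ->]] := dec v.
rewrite !lieDr (cenD d') // addr0 lieDl [lie_bracket d _]lieC (cenD d) // oppr0 addr0.
rewrite (coord_span t'X) sumX (coord_span tX) sumX.
have [e1 e2 e3 e4] := brX (coord X ord0 t') (coord X (inord 1) t')
  (coord X (inord 2) t') (coord X (inord 3) t').
rewrite !(lieDl, lieZl) e1 e2 e3 e4.
by rewrite !memvD // ?memvN ?memvZ ?memvN ?memvZ // memv_span // !inE eqxx ?orbT.
Qed.

(** If z is central and not in D, choose a complement H of the line of z that contains D. Any
    subspace containing D is an ideal, and so is a central line. *)
Lemma center_of_indecomposable : (1 < \dim (@fullv K g))%N ->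
  indecomposable g -> center_in_derived.
Proof.
move=> d1 ind z zc; apply/negPn/negP => zD; apply: ind.
pose H := (lie_derived + (lie_derived + <[z]>)^C)%VS.
have z0 : z != 0 by apply: contraNneq zD => ->; exact: mem0v.
have HZ : (<[z]> + H)%VS = fullv.
  by rewrite /H addvA [(<[z]> + _)%VS]addvC addv_complf.
have dDz : \dim (lie_derived + <[z]>) = (\dim lie_derived).+1.
  rewrite dimv_disjoint_sum ?dim_vline ?z0 ?addn1 //.
  apply/eqP; rewrite -subv0; apply/subvP => v; rewrite memv_cap => /andP [vD].
  case/vlineP => k kE; move: vD; rewrite kE memv0 => vD.
  rewrite scaler_eq0 (negbTE z0) orbF; apply: contraR zD => k0.
  by rewrite -[z]scale1r -(mulVf k0) -scalerA memvZ.
have dH : (\dim H < \dim (@fullv K g))%N.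
  apply: leq_ltn_trans (dimv_add_leqif _ _) _; rewrite dimv_compl dDz.
  have := dimvS (subvf (lie_derived + <[z]>)%VS); rewrite dDz; lia.
exists <[z]>%VS, H; split.
- by move=> x _ /vlineP [k ->]; rewrite lieZr zc scaler0 mem0v.
- move=> x y _; apply: (subvP (addvSl _ _)); exact: mem_lie_derived.
- by rewrite -dimv_eq0 dim_vline z0.
- rewrite -dimv_eq0; apply/negP => /eqP H0.
  have := leq_trans (eq_leq (congr1 (fun U => \dim U) (esym HZ)))
     (dimv_add_leqif _ _); rewrite H0 dim_vline z0; lia.
split=> //; apply/eqP; rewrite -dimv_eq0.
have := dimv_sum_cap <[z]> H; rewrite HZ dim_vline z0; lia.
Qed.

End Derived.

(** * Nilpotency, center and indecomposability of the seven algebras *)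

Section LabelProperties.
Variables (K : fieldType) (g : lieAlgType K).
Implicit Types (F : 7.-tuple g) (x y z : g) (l : label).

Lemma label_nilpotent l F : label_basis l F ->
  forall x y z, lie_bracket x (lie_bracket y z) = 0.
Proof.
move=> [bF FE] x y z; apply: (coframe_inj bF) => k kP; rewrite FE // coframe0.
by case: l FE k kP => FE [|[|[|[|[|[|[|[|k]]]]]]]] //= _; rewrite /minor2 ?FE //=; ring.
Qed.

(* lie_bracket F`_i F`_j = - F`_(4 + k) for the k-th pair (i, j); the first   *)
(* two pairs for L17 are dummies.                                             *)
Definition label_pairs l : seq (nat * nat) :=
  match l with
  | L17 => [:: (0, 0); (0, 0); (0, 1)]
  | L37A => [:: (0, 1); (1, 2); (1, 3)]
  | L37B => [:: (0, 1); (1, 2); (2, 3)]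
  | L37B1 => [:: (0, 1); (0, 2); (0, 3)]
  | L37C => [:: (0, 1); (1, 2); (1, 3)]
  | L37D => [:: (0, 1); (0, 2); (1, 3)]
  | L37D1 => [:: (0, 1); (0, 2); (0, 3)]
  end%N.

Lemma label_bracket_frame l F (k : nat) : label_basis l F -> (k < 3)%N ->
  (l = L17 -> k = 2%N) ->
  lie_bracket F`_(nth (0, 0)%N (label_pairs l) k).1
              F`_(nth (0, 0)%N (label_pairs l) k).2 = - F`_(4 + k).
Proof.
move=> [bF FE] k3 l17; have fF := basis_free bF.
apply: (coframe_inj bF) => i iP; rewrite FE // coframeN; congr (- _).
case: l FE k k3 l17 i iP => FE [|[|[|k]]] //= _ l17; try (by have := l17 erefl);
  move=> [|[|[|[|[|[|[|[|i]]]]]]]] //= _;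
  rewrite /minor2 !(coframe_nth fF) //=; ring.
Qed.

Lemma label_not_abelian l F : label_basis l F -> ~ lie_abelian g.
Proof.
move=> lF ab; have := label_bracket_frame (k := 2) lF erefl (fun _ => erefl).
rewrite ab => /(congr1 (coframe F 7)); have fF := basis_free lF.1.
rewrite coframeN coframe0 coframe_nth // => /eqP.
by rewrite eq_sym oppr_eq0 oner_eq0.
Qed.

Lemma label_two_step l F : label_basis l F -> two_step_nilpotent g.
Proof.
by move=> lF; split; [exact: label_not_abelian lF | exact: label_nilpotent lF].
Qed.

Lemma label_frame_derived l F (k : nat) : label_basis l F -> (k < 3)%N ->
  (l = L17 -> k = 2%N) -> F`_(4 + k) \in lie_derived g.
Proof.
move=> lF k3 l17; rewrite -memvN -(label_bracket_frame lF k3 l17).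
exact: mem_lie_derived.
Qed.

Lemma label_derived l F : label_basis l F -> lie_derived g =
  if l is L17 then <[F`_6]>%VS else <<drop 4 F>>%VS.
Proof.
move=> lF; have [bF FE] := lF; apply/eqP; rewrite eqEsubv; apply/andP; split.
  apply: lie_derived_min => x y; rewrite (coframe_sum (lie_bracket x y) bF) !FE //.
  case: l FE {lF} => FE /=; rewrite ?oppr0 !scale0r !add0r ?memvZ ?memv_line //;
  by rewrite !memvD // memvZ // memv_span //; apply/(nthP 0);
     [exists 0%N | exists 1%N | exists 2%N]; rewrite ?size_drop ?size_tuple ?nth_drop.
have H k := label_frame_derived (k := k) lF.
case: l H {lF FE} => H; first by rewrite -memvE; apply: (H 2%N).
all: apply/span_subvP => v /(nthP 0) [k]; rewrite size_drop size_tuple => k3 <-.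
all: by rewrite nth_drop; apply: H.
Qed.

Lemma label_dim_derived l F : label_basis l F ->
  \dim (lie_derived g) = if l is L17 then 1%N else 3%N.
Proof.
move=> lF; rewrite (label_derived lF); have [bF _] := lF; have fF := basis_free bF.
have d3 : \dim <<drop 4 F>> = 3%N.
  have : free (drop 4 F) by apply: (@catr_free _ _ (take 4 F)); rewrite cat_take_drop.
  by rewrite /free => /eqP ->; rewrite size_drop size_tuple.
have F6 : F`_6 != 0 by apply: (free_not0 fF); rewrite mem_nth // size_tuple.
by case: l lF => //; rewrite dim_vline F6.
Qed.

Ltac solve_center S N mE k j := first
  [ by apply: (S k j) => //=; rewrite !mE //=; ring
  | by apply: N; apply: (S k j) => //=; rewrite !mE //=; ring].

Lemma label_center l F : label_basis l F -> center_in_derived g.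
Proof.
move=> lF z zc; have [bF FE] := lF; have fF := basis_free bF.
have E k j : (0 < k < 8)%N -> (j < 7)%N ->
    label_form l (fun a b => minor2 F a b F`_j z) k = 0.
  move=> kP jP; apply: oppr_inj; rewrite -FE // zc coframe0 oppr0 //.
have mE a b j : (0 < a < 8)%N -> (0 < b < 8)%N -> (j < 7)%N -> minor2 F a b F`_j z =
  (a == j.+1)%:R * coframe F b z - coframe F a z * (b == j.+1)%:R.
  by move=> aP bP jP; rewrite /minor2 !coframe_nth.
have H k := label_frame_derived (k := k) lF.
rewrite (coframe_sum z bF).
suff [c1 c2 c3 c4 c56] : [/\ coframe F 1 z = 0, coframe F 2 z = 0,
    coframe F 3 z = 0, coframe F 4 z = 0 &
    l = L17 -> coframe F 5 z = 0 /\ coframe F 6 z = 0].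
  rewrite c1 c2 c3 c4 !scale0r !add0r.
  have cE (u v w : K) : l <> L17 ->
      u *: F`_4 + v *: F`_5 + w *: F`_6 \in lie_derived g.
    by move=> l17; rewrite !memvD // memvZ //;
      [apply: (H 0%N) | apply: (H 1%N) | apply: (H 2%N)].
  case: l {lF FE E} c56 H cE => c56 H cE; try exact: cE.
  by have [-> ->] := c56 erefl; rewrite !scale0r !add0r memvZ //; apply: (H 2%N).
have S k j (u : K) : (0 < k < 8)%N -> (j < 7)%N ->
    label_form l (fun a b => minor2 F a b F`_j z) k = u -> u = 0.
  by move=> kP jP <-; apply: E.
have N (u : K) : - u = 0 -> u = 0 by move/eqP; rewrite oppr_eq0 => /eqP.
move: S; clear lF FE E H; case: l => S; split=> //; try (move=> _; split).
- by solve_center S N mE 7%N 1%N.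
- by solve_center S N mE 7%N 0%N.
- by solve_center S N mE 7%N 3%N.
- by solve_center S N mE 7%N 2%N.
- by solve_center S N mE 7%N 5%N.
- by solve_center S N mE 7%N 4%N.
- by solve_center S N mE 5%N 1%N.
- by solve_center S N mE 5%N 0%N.
- by solve_center S N mE 6%N 1%N.
- by solve_center S N mE 7%N 1%N.
- by solve_center S N mE 5%N 1%N.
- by solve_center S N mE 5%N 0%N.
- by solve_center S N mE 7%N 3%N.
- by solve_center S N mE 7%N 2%N.
all: first [ by solve_center S N mE 5%N 1%N
           | by solve_center S N mE 5%N 0%N
           | by solve_center S N mE 5%N 3%N
           | by solve_center S N mE 5%N 2%N 
           | by solve_center S N mE 7%N 1%N].
Qed.

Lemma label_indecomposable l F : label_basis l F -> indecomposable g.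
Proof.
move=> lF; apply: indecomposable_of_center.
- exact: size_basis lF.1.
- exact: label_nilpotent lF.
- exact: label_center lF.
by rewrite (label_dim_derived lF); case: l lF => _; [left|right..].
Qed.

End LabelProperties.

(** * The seven algebras are pairwise non-isomorphic *)

Section LabelInvariants.
Variables (R : realFieldType) (g : lieAlgType R).
Implicit Types (F : 7.-tuple g) (x y z t : g) (l : label) (f h : g -> R^o).

Definition wedge f h x y z t : R :=
  f (lie_bracket x y) * h (lie_bracket z t)
  - f (lie_bracket x z) * h (lie_bracket y t)
  + f (lie_bracket x t) * h (lie_bracket y z)
  + f (lie_bracket y z) * h (lie_bracket x t)
  - f (lie_bracket y t) * h (lie_bracket x z)
  + f (lie_bracket z t) * h (lie_bracket x y).

Definition wedge0 f h := forall x y z t, wedge f h x y z t = 0.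
Definition vanish f := forall x y, f (lie_bracket x y) = 0.

(* For a functional f, f [., .] is a 2-form; label_quad is the symmetric      *)
(* bilinear form (f, h) |-> f [., .] /\ h [., .], in terms of the values of f *)
(* and h on the last three frame vectors.                                     *)
Definition label_quad l (u v : R * R * R) : R :=
  let: (u5, u6, u7) := u in let: (v5, v6, v7) := v in
  match l with
  | L17 | L37A => 0
  | L37B => u5 * v7 + u7 * v5
  | L37B1 => - 2 * (u5 * v5 + u6 * v6)
  | L37C => 2 * u5 * v5
  | L37D => 2 * u5 * v5 - u6 * v7 - u7 * v6
  | L37D1 => - 2 * (u5 * v5 + u6 * v6 + u7 * v7)
  end.

Definition derived_values F f : R * R * R := (f F`_4, f F`_5, f F`_6).

Lemma linear_label l F f x y : label_basis l F -> linear f -> f (lie_bracket x y) =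
  - (label_form l (fun i j => minor2 F i j x y) 5 * f F`_4
     + label_form l (fun i j => minor2 F i j x y) 6 * f F`_5
     + label_form l (fun i j => minor2 F i j x y) 7 * f F`_6).
Proof.
move=> [bF FE] fL; rewrite {1}(coframe_sum (lie_bracket x y) bF) !FE //.
have [_ fZ fD _] := linear_formE fL.
rewrite !fD !fZ; case: l FE => FE /=; ring.
Qed.

(** Outside 17 all structure equations involve only e^1, ..., e^4, so every wedge of two components
    is a multiple of e^1234, the factor being [label_quad]. *)
Lemma wedge0_label l F f h : l <> L17 -> label_basis l F -> linear f -> linear h ->
  wedge0 f h <-> label_quad l (derived_values F f) (derived_values F h) = 0.
Proof.
move=> l17 lF fL hL; have [bF FE] := lF; have fF := basis_free bF.
pose m := minor2 F.
have E x y z t : wedge f h x y z t = label_quad l (derived_values F f) (derived_values F h) *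
    (m 1%N 2%N x y * m 3%N 4%N z t - m 1%N 2%N x z * m 3%N 4%N y t + m 1%N 2%N x t * m 3%N 4%N y z
    + m 1%N 2%N y z * m 3%N 4%N x t - m 1%N 2%N y t * m 3%N 4%N x z + m 1%N 2%N z t * m 3%N 4%N x y).
  rewrite /wedge !(linear_label _ _ lF fL) !(linear_label _ _ lF hL) /m /minor2.
  by case: l l17 {lF FE} => l17 //=; ring.
split=> [H|Q0 x y z t]; last by rewrite E Q0 mul0r.
by have := H F`_0 F`_1 F`_2 F`_3; rewrite E /m /minor2 !(coframe_nth fF) //= => H0 /=; rewrite -[RHS]H0; ring.
Qed.

Lemma derived_values_surj F u : basis_of fullv F -> exists2 f, linear f & derived_values F f = u.
Proof.
move=> bF; have fF := basis_free bF; case: u => [[u5 u6] u7].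
exists (fun x => u5 * coframe F 5 x + u6 * coframe F 6 x + u7 * coframe F 7 x).
  move=> a x y /=; rewrite !coframeD !coframeZ -[_ *: _]/(_ * _); ring.
by rewrite /derived_values !(coframe_nth fF) //=; congr (_, _, _); ring.
Qed.

Lemma vanish_label l F f : l <> L17 -> label_basis l F -> linear f ->
  vanish f <-> derived_values F f = (0, 0, 0).
Proof.
move=> l17 lF fL; split=> [H|[f4 f5 f6] x y].
  have Hk k : (k < 3)%N -> f F`_(4 + k) = 0.
    move=> k3; have := H F`_(nth (0, 0)%N (label_pairs l) k).1
              F`_(nth (0, 0)%N (label_pairs l) k).2.
    have [_ _ _ fN] := linear_formE fL.
    by rewrite (label_bracket_frame lF) // fN => /eqP; rewrite oppr_eq0 => /eqP.
  by rewrite /derived_values (Hk 0%N) // (Hk 1%N) // (Hk 2%N).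
by rewrite (linear_label _ _ lF fL) f4 f5 f6 !mulr0 !addr0 oppr0.
Qed.

End LabelInvariants.

Section LabelTables.
Variables (R : realFieldType).
Implicit Types (l m : label) (u v : R * R * R).

(** The form depends on a choice of volume on g / D, hence is intrinsic only up to scale. The four
    invariants are therefore stated through its vanishing: the form is zero; its isotropic vectors
    lie in the radical; it is nondegenerate; its radical has dimension at most 1. *)
Definition quad_radical l u := forall v, label_quad l u v = 0.
Definition quad_inv1 l := forall u, @quad_radical l u.
Definition quad_inv2 l := forall u, label_quad l u u = 0 -> @quad_radical l u.
Definition quad_inv3 l := forall u, @quad_radical l u -> u = (0, 0, 0).
Definition quad_inv4 l := forall u v, @quad_radical l u -> @quad_radical l v ->
  exists a b, (a != 0) || (b != 0) /\
   (a * u.1.1 + b * v.1.1, a * u.1.2 + b * v.1.2, a * u.2 + b * v.2) = (0, 0, 0).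

(** The truth values of the four invariants; the six labels other than [L17] have pairwise different
    columns. *)
Definition table1 l := if l is L37A then true else false.
Definition table2 l := match l with L37B | L37D => false | _ => true end.
Definition table3 l := match l with L37D | L37D1 => true | _ => false end.
Definition table4 l := match l with L37A | L37C => false | _ => true end.

Lemma quad_inv1P l : l <> L17 -> quad_inv1 l <-> table1 l.
Proof.
case: l => // _; split=> // H; try by [move=> [[u5 u6] u7] [[v5 v6] v7]].
- by have := H (1, 0, 0) (0, 0, 1) => /=; lra.
- by have := H (1, 0, 0) (1, 0, 0) => /=; lra.
- by have := H (1, 0, 0) (1, 0, 0) => /=; lra.
- by have := H (1, 0, 0) (1, 0, 0) => /=; lra.
- by have := H (1, 0, 0) (1, 0, 0) => /=; lra.
Qed.

Lemma sum_sqr0 (a b c : R) : a * a + b * b + c * c = 0 -> [/\ a = 0, b = 0 & c = 0].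
Proof.
move=> H; have := (sqr_ge0 a, sqr_ge0 b, sqr_ge0 c); rewrite !expr2 => -[[a0 b0] c0].
by split; apply/eqP; rewrite -[_ == 0]orbb -mulf_eq0; apply/eqP; lra.
Qed.

Lemma quad_inv2P l : l <> L17 -> quad_inv2 l <-> table2 l.
Proof.
case: l => // _; split=> // H; try by [move=> [[u5 u6] u7] _ [[v5 v6] v7]].
- have := H (1, 0, 0) _ (0, 0, 1) => /= K; suff : (1 : R) = 0 by lra.
  rewrite -K; ring.
- move=> [[u5 u6] u7] /= E [[v5 v6] v7] /=.
  have [-> -> _] : [/\ u5 = 0, u6 = 0 & (0 : R) = 0] by apply: sum_sqr0; lra.
  ring.
- move=> [[u5 u6] u7] /= E [[v5 v6] v7] /=.
  have [-> _ _] : [/\ u5 = 0, (0 : R) = 0 & (0 : R) = 0] by apply: sum_sqr0; lra.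
  ring.
- have := H (0, 1, 0) _ (0, 0, 1) => /= K; suff : (-1 : R) = 0 by lra.
  rewrite -K; ring.
- move=> [[u5 u6] u7] /= E [[v5 v6] v7] /=.
  have [-> -> ->] : [/\ u5 = 0, u6 = 0 & u7 = 0] by apply: sum_sqr0; lra.
  ring.
Qed.

Lemma quad_inv3P l : l <> L17 -> quad_inv3 l <-> table3 l.
Proof.
case: l => // _; split=> // H.
- have [] : (1, 0, 0) = (0, 0, 0) :> R * R * R
    by apply: H => -[[v5 v6] v7] /=; ring.
  lra.
- have [] : (0, 1, 0) = (0, 0, 0) :> R * R * R
    by apply: H => -[[v5 v6] v7] /=; ring.
  lra.
- have [] : (0, 0, 1) = (0, 0, 0) :> R * R * R
    by apply: H => -[[v5 v6] v7] /=; ring.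
  lra.
- have [] : (0, 1, 0) = (0, 0, 0) :> R * R * R
    by apply: H => -[[v5 v6] v7] /=; ring.
  lra.
- move=> [[u5 u6] u7] E.
  have := (E (1, 0, 0), E (0, 1, 0), E (0, 0, 1)) => /= -[[e1 e2] e3].
  by congr (_, _, _); lra.
- move=> [[u5 u6] u7] E.
  have := (E (1, 0, 0), E (0, 1, 0), E (0, 0, 1)) => /= -[[e1 e2] e3].
  by congr (_, _, _); lra.
Qed.

Lemma dependent1 (a b : R) : exists c d, ((c != 0) || (d != 0)) /\ c * a + d * b = 0.
Proof.
have [->|b0] := eqVneq b 0; first by exists 0, 1; rewrite oner_eq0 orbT; split=> //; ring.
by exists b, (- a); rewrite b0; split=> //; ring.
Qed.

Lemma quad_inv4P l : l <> L17 -> quad_inv4 l <-> table4 l.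
Proof.
case: l => // _; split=> // H.
- have [||a [b [ab [e1 e2 _]]]] := H (1, 0, 0) (0, 1, 0).
  + by move=> [[? ?] ?].
  + by move=> [[? ?] ?].
  have a0 : a = 0 by lra.
  have b0 : b = 0 by lra.
  by move: ab; rewrite a0 b0 eqxx.
- move=> [[u5 u6] u7] [[v5 v6] v7] E E'.
  have := (E (1, 0, 0), E (0, 0, 1), E' (1, 0, 0), E' (0, 0, 1)) => /= -[[[e1 e2] e3] e4].
  have [a [b [ab e]]] := dependent1 u6 v6; exists a, b; split=> //.
  have [-> -> -> ->] : [/\ u5 = 0, v5 = 0, u7 = 0 & v7 = 0] by split; lra.
  by rewrite /= e; congr (_, _, _); ring.
- move=> [[u5 u6] u7] [[v5 v6] v7] E E'.
  have := (E (1, 0, 0), E (0, 1, 0), E' (1, 0, 0), E' (0, 1, 0)) => /= -[[[e1 e2] e3] e4].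
  have [a [b [ab e]]] := dependent1 u7 v7; exists a, b; split=> //.
  have [-> -> -> ->] : [/\ u5 = 0, v5 = 0, u6 = 0 & v6 = 0] by split; lra.
  by rewrite /= e; congr (_, _, _); ring.
- have [||a [b [ab [_ e1 e2]]]] := H (0, 1, 0) (0, 0, 1).
  + by move=> [[? ?] ?] /=; ring.
  + by move=> [[? ?] ?] /=; ring.
  have a0 : a = 0 by lra.
  have b0 : b = 0 by lra.
  by move: ab; rewrite a0 b0 eqxx.
- move=> [[u5 u6] u7] [[v5 v6] v7] E E'; exists 1, 0; rewrite oner_eq0; split=> //.
  have := (E (1, 0, 0), E (0, 1, 0), E (0, 0, 1)) => /= -[[e1 e2] e3].
  by congr (_, _, _); lra.
- move=> [[u5 u6] u7] [[v5 v6] v7] E E'; exists 1, 0; rewrite oner_eq0; split=> //.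
  have := (E (1, 0, 0), E (0, 1, 0), E (0, 0, 1)) => /= -[[e1 e2] e3].
  by congr (_, _, _); lra.
Qed.

End LabelTables.

Section LabelUnique.
Variables (R : realFieldType) (g : lieAlgType R) (l m : label) (F G : 7.-tuple g).
Hypotheses (l17 : l <> L17) (m17 : m <> L17).
Hypotheses (lF : label_basis l F) (mG : label_basis m G).

(** Both sides say that [wedge0 f h] holds, a condition that mentions no basis. *)
Lemma quad_transfer f h : linear f -> linear h ->
  label_quad l (derived_values F f) (derived_values F h) = 0 <->
  label_quad m (derived_values G f) (derived_values G h) = 0.
Proof.
move=> fL hL; apply: (iff_trans (iff_sym (wedge0_label l17 lF fL hL))).
exact: wedge0_label m17 mG fL hL.
Qed.

Lemma radical_transfer f : linear f ->
  quad_radical l (derived_values F f) <-> quad_radical m (derived_values G f).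
Proof.
move=> fL; split=> H u.
  have [h hL <-] := derived_values_surj u mG.1; exact/(quad_transfer fL hL).
by have [h hL <-] := derived_values_surj u lF.1; apply/(quad_transfer fL hL).
Qed.

Lemma zero_transfer f : linear f -> derived_values F f = (0, 0, 0) <-> derived_values G f = (0, 0, 0).
Proof.
move=> fL; apply: (iff_trans (iff_sym (vanish_label l17 lF fL))).
exact: vanish_label m17 mG fL.
Qed.

Lemma quad_inv_transfer :
  [/\ quad_inv1 R l -> quad_inv1 R m, quad_inv2 R l -> quad_inv2 R m,
      quad_inv3 R l -> quad_inv3 R m & quad_inv4 R l -> quad_inv4 R m].
Proof.
split=> H u; have [f fL <-] := derived_values_surj u mG.1.
- exact/(radical_transfer fL).
- by move=> /(quad_transfer fL fL) /H /(radical_transfer fL).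
- by move=> /(radical_transfer fL) /H /(zero_transfer fL).
move=> v; have [h hL <-] := derived_values_surj v mG.1.
move=> /(radical_transfer fL) rf /(radical_transfer hL) rh.
have [a [b [ab E]]] := H _ _ rf rh; exists a, b; split=> //.
have kL : linear (fun x => a * f x + b * h x : R^o).
  move=> c x y /=; rewrite fL hL -![_ *: _]/(_ * _); ring.
exact: (zero_transfer kL).1 E.
Qed.

End LabelUnique.

Lemma label_basis_unique (R : realFieldType) (g : lieAlgType R) (l m : label)
  (F G : 7.-tuple g) : label_basis l F -> label_basis m G -> l = m.
Proof.
move=> lF mG; have := label_dim_derived lF; rewrite (label_dim_derived mG).
have [l17|l17] := pselect (l = L17); first by rewrite l17; case: m mG.
have [m17|m17] := pselect (m = L17); first by rewrite m17; case: l lF l17.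
have [] := quad_inv_transfer l17 m17 lF mG.
have [] := quad_inv_transfer m17 l17 mG lF.
rewrite !(propext (quad_inv1P _ l17), propext (quad_inv2P _ l17),
  propext (quad_inv3P _ l17), propext (quad_inv4P _ l17)).
rewrite !(propext (quad_inv1P _ m17), propext (quad_inv2P _ m17),
  propext (quad_inv3P _ m17), propext (quad_inv4P _ m17)).
clear lF mG; case: l l17 => // _; case: m m17 => // _ h1 h2 h3 h4 h5 h6 h7 h8.
all: first [by [] | by have := h1 isT | by have := h2 isT | by have := h3 isT
  | by have := h4 isT | by have := h5 isT | by have := h6 isT | by have := h7 isT
  | by have := h8 isT].
Qed.

(** * Recognizing the seven algebras *)

Section LabelFromRelations.
Variables (K : fieldType) (g : lieAlgType K).
Implicit Types (x y z u v : g) (l : label).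

Definition spanning4 v1 v2 v3 v4 : Prop :=
  (<<[:: v1; v2; v3; v4]>> + lie_derived g)%VS = fullv.

Lemma spanning4_trans v1 v2 v3 v4 u1 u2 u3 u4 : spanning4 v1 v2 v3 v4 ->
  (forall v, v \in [:: v1; v2; v3; v4] -> v \in <<[:: u1; u2; u3; u4]>>%VS) ->
  spanning4 u1 u2 u3 u4.
Proof.
move=> sV H; apply/eqP; rewrite eqEsubv subvf -[X in (X <= _)%VS]sV /=.
by apply: addvS => //; apply/span_subvP.
Qed.

Lemma mem_span4 u1 u2 u3 u4 (a b c d : K) :
  a *: u1 + b *: u2 + c *: u3 + d *: u4 \in <<[:: u1; u2; u3; u4]>>%VS.
Proof. by rewrite !memvD // memvZ // memv_span // !inE eqxx ?orbT. Qed.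

Hypothesis d7 : \dim (@fullv K g) = 7%N.
Hypothesis nil : forall x y z, lie_bracket x (lie_bracket y z) = 0.
Hypothesis d3 : \dim (lie_derived g) = 3%N.

Lemma spanning4_dec v1 v2 v3 v4 x : spanning4 v1 v2 v3 v4 ->
  exists a b c d, exists2 e, e \in lie_derived g &
    x = a *: v1 + b *: v2 + c *: v3 + d *: v4 + e.
Proof.
move=> sV; have : x \in fullv by rewrite memvf.
rewrite -sV => /memv_addP [t tV [e eD ->]].
rewrite (@coord_span _ _ _ (in_tuple _) t tV) 4!big_ord_recl big_ord0 /= addr0 !addrA.
by do 4 eexists; exists e.
Qed.

Lemma bracket4 (a b c d a' b' c' d' : K) v1 v2 v3 v4 e e' :
  e \in lie_derived g -> e' \in lie_derived g ->
  lie_bracket (a *: v1 + b *: v2 + c *: v3 + d *: v4 + e)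
              (a' *: v1 + b' *: v2 + c' *: v3 + d' *: v4 + e') =
  (a * b' - a' * b) *: lie_bracket v1 v2 + (a * c' - a' * c) *: lie_bracket v1 v3
  + (a * d' - a' * d) *: lie_bracket v1 v4 + (b * c' - b' * c) *: lie_bracket v2 v3
  + (b * d' - b' * d) *: lie_bracket v2 v4 + (c * d' - c' * d) *: lie_bracket v3 v4.
Proof.
move=> eD e'D; have cenD := lie_derived_central nil.
rewrite lieDr (cenD e') // addr0 lieDl [lie_bracket e _]lieC (cenD e) // oppr0 addr0.
rewrite !(lieDl, lieDr, lieZl, lieZr) !liexx.
rewrite (lieC v2 v1) (lieC v3 v1) (lieC v4 v1) (lieC v3 v2) (lieC v4 v2) (lieC v4 v3).
apply: vect_ext => f fL.
have [f0 fZ fD fN] := linear_formE fL.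
rewrite !(fD, fZ, fN, f0); ring.
Qed.

(** The value of e^{ab} on the i-th and j-th basis vectors, for a < b and i < j only. *)
Definition delta_form (i j a b : nat) : K := ((a == i) && (b == j))%:R.

(** By the relations all brackets lie in the span of [z5], [z6], [z7]. As dim D = 3, that span is D,
    so the seven vectors span g and form a basis; independence need not be checked separately. *)
Lemma label_of_relations l v1 v2 v3 v4 z5 z6 z7
    (br := fun i j => - (label_form l (delta_form i j) 5 *: z5
      + label_form l (delta_form i j) 6 *: z6 + label_form l (delta_form i j) 7 *: z7)) :
  l <> L17 -> spanning4 v1 v2 v3 v4 ->
  lie_bracket v1 v2 = br 1%N 2%N -> lie_bracket v1 v3 = br 1%N 3%N ->
  lie_bracket v1 v4 = br 1%N 4%N -> lie_bracket v2 v3 = br 2%N 3%N ->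
  lie_bracket v2 v4 = br 2%N 4%N -> lie_bracket v3 v4 = br 3%N 4%N ->
  label_basis l [tuple v1; v2; v3; v4; z5; z6; z7].
Proof.
move=> l17 sV b12 b13 b14 b23 b24 b34.
set F := [tuple _; _; _; _; _; _; _].
have brZ i j : br i j \in <<[:: z5; z6; z7]>>%VS.
  by rewrite memvN !memvD // memvZ // memv_span // !inE eqxx ?orbT.
have DZ : (lie_derived g <= <<[:: z5; z6; z7]>>)%VS.
  apply: lie_derived_min => x y.
  have [a [b [c [d [e eD ->]]]]] := spanning4_dec x sV.
  have [a' [b' [c' [d' [e' e'D ->]]]]] := spanning4_dec y sV.
  by rewrite bracket4 // b12 b13 b14 b23 b24 b34 !memvD // memvZ.
have DE : lie_derived g = <<[:: z5; z6; z7]>>%VS.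
  by apply/eqP; rewrite eqEdim DZ d3 dim_span.
have bF : basis_of fullv F.
  rewrite basisEdim size_tuple d7 leqnn andbT -sV DE -span_cat.
  exact: subvv.
have zD z : z \in [:: z5; z6; z7] -> z \in lie_derived g.
  by move=> zz; rewrite DE memv_span.
split=> // x y k kP; have fF := basis_free bF.
have dec u : u = coframe F 1 u *: v1 + coframe F 2 u *: v2 + coframe F 3 u *: v3
    + coframe F 4 u *: v4 + (coframe F 5 u *: z5 + coframe F 6 u *: z6 + coframe F 7 u *: z7).
  by rewrite {1}(coframe_sum u bF) -!addrA.
rewrite (dec x) (dec y) bracket4 ?b12 ?b13 ?b14 ?b23 ?b24 ?b34; first last.
- by rewrite !memvD // memvZ // zD // !inE eqxx ?orbT.
- by rewrite !memvD // memvZ // zD // !inE eqxx ?orbT.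
rewrite -(dec x) -(dec y) /br.
have E5 : coframe F k z5 = (k == 5%N)%:R by have := coframe_nth fF kP (isT : (4 < 7)%N).
have E6 : coframe F k z6 = (k == 6%N)%:R by have := coframe_nth fF kP (isT : (5 < 7)%N).
have E7 : coframe F k z7 = (k == 7%N)%:R by have := coframe_nth fF kP (isT : (6 < 7)%N).
rewrite !(coframeD, coframeZ, coframeN) E5 E6 E7 /minor2.
clear - l17 kP.
case: l l17 => // _; case: k kP => [|[|[|[|[|[|[|[|k]]]]]]]] //= _;
  rewrite /delta_form /=; ring.
Qed.

End LabelFromRelations.

(** * From relations in normal form to the six algebras with dim D = 3 *)

Section LabelFromNet.
Variables (R : rcfType) (g : lieAlgType R).
Implicit Types (v u : g) (l : label).

Hypothesis d7 : \dim (@fullv R g) = 7%N.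
Hypothesis nil : forall x y z : g, lie_bracket x (lie_bracket y z) = 0.
Hypothesis d3 : \dim (lie_derived g) = 3%N.

(* The relations satisfied by v, vT, vS, vST if T^2 = a, S^2 = b, ST = - TS.  *)
Definition net_relations (a b : R) v1 v2 v3 v4 : Prop :=
  [/\ lie_bracket v1 v4 = lie_bracket v2 v3,
      lie_bracket v2 v4 = a *: lie_bracket v1 v3 &
      lie_bracket v3 v4 = - b *: lie_bracket v1 v2].

Ltac vect_ring :=
  let f := fresh "f" in let fL := fresh "fL" in
  let f0 := fresh "f0" in let fZ := fresh "fZ" in
  let fD := fresh "fD" in let fN := fresh "fN" in
  apply: vect_ext => f fL; have [f0 fZ fD fN] := linear_formE fL;
  rewrite ?(fD, fZ, fN, f0) /=; try by field.

Ltac lie_ring v1 v2 v3 v4 h14 h24 h34 :=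
  rewrite /delta_form /= ?(lieDl, lieDr, lieZl, lieZr, lieNl, lieNr, liexx);
  rewrite ?(lieC v2 v1) ?(lieC v3 v1) ?(lieC v4 v1) ?(lieC v3 v2) ?(lieC v4 v2)
    ?(lieC v4 v3) ?h14 ?h24 ?h34; vect_ring.

Lemma mem_span4E u1 u2 u3 u4 a b c d v :
  v = a *: u1 + b *: u2 + c *: u3 + d *: u4 -> v \in <<[:: u1; u2; u3; u4]>>%VS.
Proof. by move=> ->; exact: mem_span4. Qed.

Ltac span_by a b c d :=
  apply: (mem_span4E (a := a) (b := b) (c := c) (d := d)); vect_ring.

Lemma mem4 v1 v2 v3 v4 (P : g -> Prop) : P v1 -> P v2 -> P v3 -> P v4 ->
  forall v, v \in [:: v1; v2; v3; v4] -> P v.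
Proof. by move=> p1 p2 p3 p4 v; rewrite !inE => /or4P [] /eqP ->. Qed.

(** Exchange of T and S; the sign of [v4] comes from vTS = - vST. *)
Lemma net_relations_swap a b v1 v2 v3 v4 :
  net_relations a b v1 v2 v3 v4 -> net_relations b a v1 v3 v2 (- v4).
Proof.
move=> [h14 h24 h34]; split; lie_ring v1 v2 v3 v4 h14 h24 h34.
Qed.

(** Replacement of T by sT and of S by tS. *)
Lemma net_relations_scale a b s t v1 v2 v3 v4 :
  net_relations a b v1 v2 v3 v4 ->
  net_relations (s * s * a) (t * t * b) v1 (s *: v2) (t *: v3) (s * t *: v4).
Proof.
move=> [h14 h24 h34]; split; lie_ring v1 v2 v3 v4 h14 h24 h34.
Qed.

Lemma net_label_37D1 v1 v2 v3 v4 : spanning4 v1 v2 v3 v4 ->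
  net_relations (-1) (-1) v1 v2 v3 v4 -> exists F : 7.-tuple g, label_basis L37D1 F.
Proof.
move=> sV [h14 h24 h34]; eexists.
apply: (label_of_relations (v1 := - v1) (v2 := v2) (v3 := v3) (v4 := v4)
  (* The last three vectors are minus brackets, here and in the next lemmas, because de^k (x, y) = -
     e^k ([x, y]). *)
  (z5 := - lie_bracket (- v1) (v2)) (z6 := - lie_bracket (- v1) (v3))
  (z7 := - lie_bracket (- v1) (v4)) d7 nil d3) => //.
  apply: (spanning4_trans sV); apply: mem4.
  - by span_by (-1 : R) (0 : R) (0 : R) (0 : R).
  - by span_by (0 : R) (1 : R) (0 : R) (0 : R).
  - by span_by (0 : R) (0 : R) (1 : R) (0 : R).
  - by span_by (0 : R) (0 : R) (0 : R) (1 : R).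
all: by lie_ring v1 v2 v3 v4 h14 h24 h34.
Qed.

Lemma net_label_37B1 v1 v2 v3 v4 : spanning4 v1 v2 v3 v4 ->
  net_relations (-1) 0 v1 v2 v3 v4 -> exists F : 7.-tuple g, label_basis L37B1 F.
Proof.
move=> sV [h14 h24 h34]; eexists.
apply: (label_of_relations (v1 := v1) (v2 := v3) (v3 := v4) (v4 := - v2)
  (z5 := - lie_bracket (v1) (v3)) (z6 := - lie_bracket (v1) (v4))
  (z7 := - lie_bracket (v1) (- v2)) d7 nil d3) => //.
  apply: (spanning4_trans sV); apply: mem4.
  - by span_by (1 : R) (0 : R) (0 : R) (0 : R).
  - by span_by (0 : R) (0 : R) (0 : R) (-1 : R).
  - by span_by (0 : R) (1 : R) (0 : R) (0 : R).
  - by span_by (0 : R) (0 : R) (1 : R) (0 : R).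
all: by lie_ring v1 v2 v3 v4 h14 h24 h34.
Qed.

Lemma net_label_37C v1 v2 v3 v4 : spanning4 v1 v2 v3 v4 ->
  net_relations 0 0 v1 v2 v3 v4 -> exists F : 7.-tuple g, label_basis L37C F.
Proof.
move=> sV [h14 h24 h34]; eexists.
apply: (label_of_relations (v1 := v4) (v2 := - v1) (v3 := v2) (v4 := v3)
  (z5 := - lie_bracket (v4) (- v1)) (z6 := - lie_bracket (- v1) (v2))
  (z7 := - lie_bracket (- v1) (v3)) d7 nil d3) => //.
  apply: (spanning4_trans sV); apply: mem4.
  - by span_by (0 : R) (-1 : R) (0 : R) (0 : R).
  - by span_by (0 : R) (0 : R) (1 : R) (0 : R).
  - by span_by (0 : R) (0 : R) (0 : R) (1 : R).
  - by span_by (1 : R) (0 : R) (0 : R) (0 : R).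
all: by lie_ring v1 v2 v3 v4 h14 h24 h34.
Qed.

(** When a = 1, T is an involution, and v + vT, v - vT, vS + vST, vS - vST are eigenvectors of it.
    The two lemmas for 37D use the same change of basis, up to order and sign. *)
Lemma net_label_37B v1 v2 v3 v4 : spanning4 v1 v2 v3 v4 ->
  net_relations 1 0 v1 v2 v3 v4 -> exists F : 7.-tuple g, label_basis L37B F.
Proof.
move=> sV [h14 h24 h34]; eexists.
apply: (label_of_relations (v1 := v3 - v4) (v2 := v1 - v2) (v3 := v1 + v2) (v4 := v3 + v4)
  (z5 := - lie_bracket (v3 - v4) (v1 - v2)) (z6 := - lie_bracket (v1 - v2) (v1 + v2))
  (z7 := - lie_bracket (v1 + v2) (v3 + v4)) d7 nil d3) => //.
  apply: (spanning4_trans sV); apply: mem4.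
  - by span_by (0 : R) (1/2 : R) (1/2 : R) (0 : R).
  - by span_by (0 : R) (-1/2 : R) (1/2 : R) (0 : R).
  - by span_by (1/2 : R) (0 : R) (0 : R) (1/2 : R).
  - by span_by (-1/2 : R) (0 : R) (0 : R) (1/2 : R).
all: by lie_ring v1 v2 v3 v4 h14 h24 h34.
Qed.

Lemma net_label_37D_pos v1 v2 v3 v4 : spanning4 v1 v2 v3 v4 ->
  net_relations 1 1 v1 v2 v3 v4 -> exists F : 7.-tuple g, label_basis L37D F.
Proof.
move=> sV [h14 h24 h34]; eexists.
apply: (label_of_relations (v1 := v1 + v2) (v2 := v1 - v2) (v3 := - (v3 + v4)) (v4 := v3 - v4)
  (z5 := - lie_bracket (v1 + v2) (v1 - v2)) (z6 := - lie_bracket (v1 + v2) (- (v3 + v4)))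
  (z7 := - lie_bracket (v1 - v2) (v3 - v4)) d7 nil d3) => //.
  apply: (spanning4_trans sV); apply: mem4.
  - by span_by (1/2 : R) (1/2 : R) (0 : R) (0 : R).
  - by span_by (1/2 : R) (-1/2 : R) (0 : R) (0 : R).
  - by span_by (0 : R) (0 : R) (-1/2 : R) (1/2 : R).
  - by span_by (0 : R) (0 : R) (-1/2 : R) (-1/2 : R).
all: by lie_ring v1 v2 v3 v4 h14 h24 h34.
Qed.

Lemma net_label_37D_neg v1 v2 v3 v4 : spanning4 v1 v2 v3 v4 ->
  net_relations 1 (-1) v1 v2 v3 v4 -> exists F : 7.-tuple g, label_basis L37D F.
Proof.
move=> sV [h14 h24 h34]; eexists.
apply: (label_of_relations (v1 := v1 + v2) (v2 := v1 - v2) (v3 := v3 + v4) (v4 := v3 - v4)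
  (z5 := - lie_bracket (v1 + v2) (v1 - v2)) (z6 := - lie_bracket (v1 + v2) (v3 + v4))
  (z7 := - lie_bracket (v1 - v2) (v3 - v4)) d7 nil d3) => //.
  apply: (spanning4_trans sV); apply: mem4.
  - by span_by (1/2 : R) (1/2 : R) (0 : R) (0 : R).
  - by span_by (1/2 : R) (-1/2 : R) (0 : R) (0 : R).
  - by span_by (0 : R) (0 : R) (1/2 : R) (1/2 : R).
  - by span_by (0 : R) (0 : R) (1/2 : R) (-1/2 : R).
all: by lie_ring v1 v2 v3 v4 h14 h24 h34.
Qed.

Lemma label_37A_of_relations v1 v2 v3 v4 : spanning4 v1 v2 v3 v4 ->
  lie_bracket v1 v3 = 0 -> lie_bracket v1 v4 = 0 -> lie_bracket v3 v4 = 0 ->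
  exists F : 7.-tuple g, label_basis L37A F.
Proof.
move=> sV h13 h14 h34; eexists.
apply: (label_of_relations (z5 := - lie_bracket v1 v2) (z6 := - lie_bracket v2 v3)
  (z7 := - lie_bracket v2 v4) d7 nil d3 _ sV) => //; rewrite ?h13 ?h14 ?h34.
all: rewrite /delta_form /=; vect_ring.
Qed.

Lemma exists_scale (a : R) : exists2 s : R, s != 0 &
  [\/ s * s * a = 0, s * s * a = 1 | s * s * a = -1].
Proof.
have [->|a0] := eqVneq a 0; first by exists 1; rewrite ?oner_eq0 // mulr0; constructor 1.
have n0 : 0 < `|a| by rewrite normr_gt0.
have s0 : Num.sqrt `|a| != 0 by rewrite sqrtr_eq0 -ltNge.
exists (Num.sqrt `|a|)^-1; first by rewrite invr_eq0.
rewrite -invfM -expr2 sqr_sqrtr ?normr_ge0 //.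
have a1 := a0; case: (ltrgt0P a) a0 => // ap _; [constructor 2 | constructor 3].
  by rewrite mulVf.
by rewrite invrN mulNr mulVf.
Qed.

(** Scaling makes a and b equal to 0, 1 or -1, and the swap makes the pair unordered. The pairs (1,
    1) and (1, -1) both give 37D. *)
Lemma label_of_net a b v1 v2 v3 v4 : spanning4 v1 v2 v3 v4 ->
  net_relations a b v1 v2 v3 v4 -> exists l (F : 7.-tuple g), label_basis l F.
Proof.
have [s s0 sP] := exists_scale a; have [t t0 tP] := exists_scale b.
move=> sV /(net_relations_scale s t).
have : spanning4 v1 (s *: v2) (t *: v3) (s * t *: v4).
  apply: (spanning4_trans sV); apply: mem4.
  - by span_by (1 : R) (0 : R) (0 : R) (0 : R).
  - by span_by (0 : R) s^-1 (0 : R) (0 : R).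
  - by span_by (0 : R) (0 : R) t^-1 (0 : R).
  - by span_by (0 : R) (0 : R) (0 : R) (s * t)^-1; field; rewrite s0 t0.
move: sP tP; move: (s * s * a) (t * t * b) (s *: v2) (t *: v3) (s * t *: v4).
move=> {}a {}b {}v2 {}v3 {}v4 aP bP {}sV net.
have sV' : spanning4 v1 v3 v2 (- v4).
  apply: (spanning4_trans sV); apply: mem4.
  - by span_by (1 : R) (0 : R) (0 : R) (0 : R).
  - by span_by (0 : R) (0 : R) (1 : R) (0 : R).
  - by span_by (0 : R) (1 : R) (0 : R) (0 : R).
  - by span_by (0 : R) (0 : R) (0 : R) (-1 : R).
have net' := net_relations_swap net.
case: aP net net' => ->; case: bP => -> net net'.
- by exists L37C; exact: net_label_37C sV net.
- by exists L37B; exact: net_label_37B sV' net'.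
- by exists L37B1; exact: net_label_37B1 sV' net'.
- by exists L37B; exact: net_label_37B sV net.
- by exists L37D; exact: net_label_37D_pos sV net.
- by exists L37D; exact: net_label_37D_neg sV net.
- by exists L37B1; exact: net_label_37B1 sV net.
- by exists L37D; exact: net_label_37D_neg sV' net'.
- by exists L37D1; exact: net_label_37D1 sV net.
Qed.

End LabelFromNet.

(** Lets [linfun] and [lker] be applied to the bracket with x, to define [centralizer]. *)
HB.instance Definition _ (K : fieldType) (g : lieAlgType K) (x : g) :=
  GRing.isLinear.Build K g g _ (lie_bracket x)
    (lie_bracket_linear_r (@lie_bracketP _ g) x).

(** * One-dimensional derived algebra *)

Section DerivedLine.
Variables (K : fieldType) (g : lieAlgType K).
Implicit Types (x y z u v : g) (U : {vspace g}).

Definition centralizer x : {vspace g} := lker (linfun (lie_bracket x)).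

Lemma mem_centralizer x y : (y \in centralizer x) = (lie_bracket x y == 0).
Proof. by rewrite memv_ker lfunE. Qed.

Definition nondegenerate_on U : Prop :=
  forall x, x \in U -> (forall y, y \in U -> lie_bracket x y = 0) -> x \in lie_derived g.

Variable z : g.
Hypotheses (z0 : z != 0) (Dz : lie_derived g = <[z]>%VS).

Lemma bracket_line x y : exists c, lie_bracket x y = c *: z.
Proof. by apply/vlineP; rewrite -Dz mem_lie_derived. Qed.

(** A step of symplectic Gram-Schmidt: rescale a pair with nonzero bracket so that its bracket is z.
    U is then the sum of its span and of the part of U centralizing it, on which nondegeneracy
    persists. *)
Lemma hyperbolic_pair U : nondegenerate_on U -> (1 < \dim U)%N ->
  exists x y, [/\ x \in U, y \in U, lie_bracket x y = z &
   nondegenerate_on (U :&: (centralizer x :&: centralizer y)) /\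
   (\dim U <= 2 + \dim (U :&: (centralizer x :&: centralizer y)))%N].
Proof.
move=> ndU dU.
have [x xU xD] : exists2 x, x \in U & x \notin lie_derived g.
  apply: contrapT => H; have : (U <= lie_derived g)%VS.
    by apply/subvP => x xU; apply/negPn/negP => xD; apply: H; exists x.
  by move/dimvS; rewrite Dz dim_vline z0; lia.
have [y yU xy] : exists2 y, y \in U & lie_bracket x y != 0.
  apply: contrapT => H; move/negP: xD; apply; apply: ndU => // y yU.
  by apply/eqP/negPn/negP => xy; apply: H; exists y.
have [c cE] := bracket_line x y.
have c0 : c != 0 by apply: contra xy => /eqP c0; rewrite cE c0 scale0r.
pose y' := c^-1 *: y; have xy' : lie_bracket x y' = z.
  by rewrite lieZr cE scalerA mulVf // scale1r.
have y'U : y' \in U by rewrite memvZ.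
clearbody y'.
exists x, y'; split=> //; set V := (U :&: _)%VS.
have dec u : u \in U -> exists a b, exists2 v, v \in V & u = a *: x + b *: y' + v.
  move=> uU; have [a aE] := bracket_line u y'; have [b bE] := bracket_line x u.
  exists a, b, (u - (a *: x + b *: y')); last by rewrite addrC subrK.
  rewrite !memv_cap !mem_centralizer; apply/and3P; split.
  - by rewrite memvB // memvD // memvZ.
  - rewrite lieDr lieNr lieDr !lieZr liexx bE xy'.
    by rewrite scaler0 add0r subrr.
  rewrite lieDr lieNr lieDr !lieZr liexx (lieC y' u) aE (lieC y' x) xy'.
  by rewrite scaler0 addr0 scalerN opprK addNr.
split.
  move=> v; rewrite !memv_cap !mem_centralizer => /and3P [vU /eqP vx /eqP vy] vV.
  apply: ndU => // u /dec [a [b [t tV ->]]].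
  by rewrite !lieDr !lieZr (vV t tV) (lieC v x) (lieC v y') vx vy !oppr0 !scaler0 !addr0.
have /dimvS : (U <= <<[:: x; y']>> + V)%VS.
  apply/subvP => u /dec [a [b [t tV ->]]]; apply: memv_add => //.
  by rewrite memvD // memvZ // memv_span // !inE eqxx ?orbT.
move=> /leq_trans; apply; apply: leq_trans (dimv_add_leqif _ _) _.
by rewrite leq_add2r dim_span.
Qed.

Lemma label_17_of_line : \dim (@fullv K g) = 7%N -> center_in_derived g ->
  (forall x, lie_bracket x z = 0) ->
  exists F : 7.-tuple g, label_basis L17 F.
Proof.
move=> d7 cen zc.
have nd : nondegenerate_on (@fullv K g).
  by move=> x _ H; apply: cen => y; rewrite lieC H ?memvf // oppr0.
(* The three successive subspaces have dimensions 7, at least 5 and at least 3, so a pair can be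
   split off each time. *)
have [|x1 [y1 [_ _ b1 [nd1 d1]]]] := hyperbolic_pair nd; first by rewrite d7.
have [|x2 [y2 [x2U y2U b2 [nd2 d2]]]] := hyperbolic_pair nd1; first by lia.
have [|x3 [y3 [x3U y3U b3 _]]] := hyperbolic_pair nd2; first by lia.
move: x2U y2U; rewrite !memv_cap !mem_centralizer !memvf /=.
move=> /andP [/eqP x12 /eqP y1x2] /andP [/eqP x1y2 /eqP y12].
move: x3U y3U; rewrite !memv_cap !mem_centralizer !memvf /=.
move=> /andP [/andP [/eqP x13 /eqP y1x3] /andP [/eqP x23 /eqP y2x3]].
move=> /andP [/andP [/eqP x1y3 /eqP y13] /andP [/eqP x2y3 /eqP y23]].
pose F := [tuple x1; y1; x2; y2; x3; y3; - z].
have zl x : lie_bracket z x = 0 by rewrite lieC zc oppr0.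
have rev u v : lie_bracket u v = 0 -> lie_bracket v u = 0.
  by move=> uv; rewrite lieC uv oppr0.
have b1' : lie_bracket y1 x1 = - z by rewrite lieC b1.
have b2' : lie_bracket y2 x2 = - z by rewrite lieC b2.
have b3' : lie_bracket y3 x3 = - z by rewrite lieC b3.
have br := (@liexx K g, zl, zc, b1, b2, b3, (b1', b2', b3'),
  (x12, y1x2, x1y2, y12), (x13, y1x3, x23, y2x3), (x1y3, y13, x2y3, y23),
  (rev _ _ x12, rev _ _ y1x2, rev _ _ x1y2, rev _ _ y12),
  (rev _ _ x13, rev _ _ y1x3, rev _ _ x23, rev _ _ y2x3),
  (rev _ _ x1y3, rev _ _ y13, rev _ _ x2y3, rev _ _ y23)).
have simp := (lieDl, lieDr, lieZl, lieZr, lieNl, lieNr).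
have kz v w c : lie_bracket w v = c *: z -> w = 0 -> c = 0.
  move=> wv w0; move: wv; rewrite w0 lie0l => /esym/eqP.
  by rewrite scaler_eq0 (negbTE z0) orbF => /eqP.
(* Each coefficient is read off by bracketing with the symplectic partner of its vector; [w0'], the
   negated relation, absorbs the sign for the y's. *)
have coef (a0 a1 a2 a3 a4 a5 a6 : K) : a0 *: x1 + a1 *: y1 + a2 *: x2 + a3 *: y2
    + a4 *: x3 + a5 *: y3 + a6 *: - z = 0 ->
    [/\ a0 = 0, a1 = 0, a2 = 0 & a3 = 0] /\ [/\ a4 = 0, a5 = 0 & a6 = 0].
  move=> w0; have w0' : - (a0 *: x1 + a1 *: y1 + a2 *: x2 + a3 *: y2
    + a4 *: x3 + a5 *: y3 + a6 *: - z) = 0 by rewrite w0 oppr0.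
  have e0 : a0 = 0.
    by apply: (kz y1 _ _ _ w0); rewrite !simp !br ?(scaler0, oppr0, addr0, add0r).
  have e1 : a1 = 0.
    apply: (kz x1 _ _ _ w0'); rewrite !simp !br ?(scaler0, oppr0, addr0, add0r).
    by rewrite scalerN opprK.
  have e2 : a2 = 0.
    by apply: (kz y2 _ _ _ w0); rewrite !simp !br ?(scaler0, oppr0, addr0, add0r).
  have e3 : a3 = 0.
    apply: (kz x2 _ _ _ w0'); rewrite !simp !br ?(scaler0, oppr0, addr0, add0r).
    by rewrite scalerN opprK.
  have e4 : a4 = 0.
    by apply: (kz y3 _ _ _ w0); rewrite !simp !br ?(scaler0, oppr0, addr0, add0r).
  have e5 : a5 = 0.
    apply: (kz x3 _ _ _ w0'); rewrite !simp !br ?(scaler0, oppr0, addr0, add0r).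
    by rewrite scalerN opprK.
  split=> //; split=> //; apply/eqP; move/eqP: w0.
  by rewrite e0 e1 e2 e3 e4 e5 !scale0r !add0r scaler_eq0 oppr_eq0 (negbTE z0) orbF.
have fF : free F.
  apply/freeP => k; rewrite !big_ord_recl big_ord0 addr0 !addrA.
  move=> /coef [[k0 k1 k2 k3] [k4 k5 k6]] -[[|[|[|[|[|[|[|i]]]]]]] Hi] //.
  - by rewrite -[RHS]k0; congr k; apply: val_inj.
  - by rewrite -[RHS]k1; congr k; apply: val_inj.
  - by rewrite -[RHS]k2; congr k; apply: val_inj.
  - by rewrite -[RHS]k3; congr k; apply: val_inj.
  - by rewrite -[RHS]k4; congr k; apply: val_inj.
  - by rewrite -[RHS]k5; congr k; apply: val_inj.
  - by rewrite -[RHS]k6; congr k; apply: val_inj.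
have bF : basis_of fullv F by rewrite basisEfree fF subvf d7 size_tuple.
exists F; split=> // x y k kP.
have E : lie_bracket x y =
    (minor2 F 1 2 x y + minor2 F 3 4 x y + minor2 F 5 6 x y) *: z.
  rewrite {1}(coframe_sum x bF) {1}(coframe_sum y bF) /=.
  rewrite !(lieDl, lieDr) !(lieZl, lieZr, lieNl, lieNr) !br.
  rewrite ?(scaler0, oppr0, addr0, add0r) /minor2.
  apply: vect_ext => f fL.
  have [f0 fZ fD fN] := linear_formE fL.
  rewrite !(fD, fZ, fN, f0); ring.
have zE : coframe F k z = - (k == 7%N)%:R.
  have := coframe_nth fF kP (isT : (6 < 7)%N).
  by rewrite /= coframeN => <-; rewrite opprK.
rewrite E coframeZ zE.
by case: k kP {zE} => [|[|[|[|[|[|[|[|k]]]]]]]] //= _; ring.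
Qed.

End DerivedLine.

(** * Two-dimensional derived algebra *)

Section CrossProduct.
Variable R : realFieldType.
Implicit Types X Y B : nat -> R.

Definition plucker X Y (i j : nat) : R := X i * Y j - X j * Y i.

(* cross X Y k = phi(x, y, E_k) and sigma X Y c d = psi(x, y, E_c, E_d) for   *)
(* vectors x, y with coordinates X, Y in the adapted frame E.                 *)
Definition cross X Y (k : nat) : R :=
  let m := plucker X Y in
  match k with
  | 1 => m 2%N 7%N + m 3%N 5%N - m 4%N 6%N
  | 2 => - m 1%N 7%N - m 3%N 6%N - m 4%N 5%N
  | 3 => m 4%N 7%N - m 1%N 5%N + m 2%N 6%N
  | 4 => - m 3%N 7%N + m 1%N 6%N + m 2%N 5%N
  | 5 => m 6%N 7%N + m 1%N 3%N - m 2%N 4%N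
  | 6 => - m 5%N 7%N - m 1%N 4%N - m 2%N 3%N
  | 7 => m 1%N 2%N + m 3%N 4%N + m 5%N 6%N
  | _ => 0
  end.

Definition sigma X Y (c d : nat) : R :=
  let m := plucker X Y in
  match c, d with
  | 1, 2 => m 3%N 4%N + m 5%N 6%N
  | 1, 3 => - m 2%N 4%N + m 6%N 7%N
  | 1, 4 => m 2%N 3%N + m 5%N 7%N
  | 1, 5 => - m 2%N 6%N - m 4%N 7%N
  | 1, 6 => m 2%N 5%N - m 3%N 7%N
  | 1, 7 => m 3%N 6%N + m 4%N 5%N
  | 2, 1 => - m 3%N 4%N - m 5%N 6%N
  | 2, 3 => m 1%N 4%N + m 5%N 7%N
  | 2, 4 => - m 1%N 3%N - m 6%N 7%N
  | 2, 5 => m 1%N 6%N - m 3%N 7%N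
  | 2, 6 => - m 1%N 5%N + m 4%N 7%N
  | 2, 7 => m 3%N 5%N - m 4%N 6%N
  | 3, 1 => m 2%N 4%N - m 6%N 7%N
  | 3, 2 => - m 1%N 4%N - m 5%N 7%N
  | 3, 4 => m 1%N 2%N + m 5%N 6%N
  | 3, 5 => m 2%N 7%N - m 4%N 6%N
  | 3, 6 => m 1%N 7%N + m 4%N 5%N
  | 3, 7 => - m 1%N 6%N - m 2%N 5%N
  | 4, 1 => - m 2%N 3%N - m 5%N 7%N
  | 4, 2 => m 1%N 3%N + m 6%N 7%N
  | 4, 3 => - m 1%N 2%N - m 5%N 6%N
  | 4, 5 => m 1%N 7%N + m 3%N 6%N
  | 4, 6 => - m 2%N 7%N - m 3%N 5%N
  | 4, 7 => - m 1%N 5%N + m 2%N 6%N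
  | 5, 1 => m 2%N 6%N + m 4%N 7%N
  | 5, 2 => - m 1%N 6%N + m 3%N 7%N
  | 5, 3 => - m 2%N 7%N + m 4%N 6%N
  | 5, 4 => - m 1%N 7%N - m 3%N 6%N
  | 5, 6 => m 1%N 2%N + m 3%N 4%N
  | 5, 7 => m 1%N 4%N + m 2%N 3%N
  | 6, 1 => - m 2%N 5%N + m 3%N 7%N
  | 6, 2 => m 1%N 5%N - m 4%N 7%N
  | 6, 3 => - m 1%N 7%N - m 4%N 5%N
  | 6, 4 => m 2%N 7%N + m 3%N 5%N
  | 6, 5 => - m 1%N 2%N - m 3%N 4%N
  | 6, 7 => m 1%N 3%N - m 2%N 4%N
  | 7, 1 => - m 3%N 6%N - m 4%N 5%N
  | 7, 2 => - m 3%N 5%N + m 4%N 6%N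
  | 7, 3 => m 1%N 6%N + m 2%N 5%N
  | 7, 4 => m 1%N 5%N - m 2%N 6%N
  | 7, 5 => - m 1%N 4%N - m 2%N 3%N
  | 7, 6 => - m 1%N 3%N + m 2%N 4%N
  | _, _ => 0
  end.

Definition dot X Y : R := \sum_(i < 7) X i.+1 * Y i.+1.

Lemma dot_eq0 X : dot X X = 0 -> forall i, (0 < i < 8)%N -> X i = 0.
Proof.
move=> /eqP; rewrite psumr_eq0 => [/allP H i iP|i _]; last by rewrite -expr2 sqr_ge0.
have /implyP := H (inord i.-1) (mem_index_enum _).
by case: i iP => // i /= i7 /(_ isT); rewrite inordK // mulf_eq0 orbb => /eqP.
Qed.

Ltac sum7 := rewrite /dot !big_ord_recl !big_ord0 /= /bump /= ?add0n /=.

Lemma cross_orthogonal X Y : dot (cross X Y) X = 0 /\ dot (cross X Y) Y = 0.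
Proof. by split; sum7; rewrite /cross /plucker /=; ring. Qed.

Lemma cross_norm X Y :
  dot (cross X Y) (cross X Y) = dot X X * dot Y Y - dot X Y * dot X Y.
Proof. by sum7; rewrite /cross /plucker /=; ring. Qed.

(* Contracting B /\ sigma with sigma gives back B, up to the factor           *)
(* |x /\ y|^2 and to terms that vanish if B vanishes on x, y and x \times y.  *)
Lemma contraction_by_sigma X Y B i : (0 < i < 8)%N ->
  \sum_(c < 7) \sum_(d < 7) sigma X Y c.+1 d.+1 *
    (B i * sigma X Y c.+1 d.+1 - B c.+1 * sigma X Y i d.+1
     + B d.+1 * sigma X Y i c.+1) =
  2 * ((dot X X * dot Y Y - dot X Y * dot X Y) * B i
    + X i * (dot Y Y * dot B X - dot X Y * dot B Y)
    + Y i * (dot X X * dot B Y - dot X Y * dot B X)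
    + cross X Y i * dot B (cross X Y)).
Proof.
move=> iP; sum7.
by case: i iP => [|[|[|[|[|[|[|[|i]]]]]]]] //= _; rewrite /plucker; ring.
Qed.

(** The equality case of Cauchy-Schwarz: |<Y,Y> X - <X,Y> Y|^2 is <Y,Y> times the Gram
    determinant. *)
Lemma gram_eq0 X Y : dot X X * dot Y Y - dot X Y * dot X Y = 0 ->
  forall i, (0 < i < 8)%N -> dot Y Y * X i = dot X Y * Y i.
Proof.
move=> G0 i iP; apply/eqP; rewrite -subr_eq0; apply/eqP.
apply: (@dot_eq0 (fun i => dot Y Y * X i - dot X Y * Y i)) => //.
rewrite -(mulr0 (dot Y Y)) -G0; sum7; ring.
Qed.

End CrossProduct.

Section DerivedPlane.
Variables (R : realType) (g : lieAlgType R) (E : 7.-tuple g).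
Hypothesis bE : basis_of fullv E.
Implicit Types (x y z u v : g).
Let c := fun x i => coframe E i x.

Definition cross_vect x y : g := \sum_(i < 7) cross (c x) (c y) i.+1 *: E`_i.

Lemma coframe_cross x y i : (0 < i < 8)%N ->
  coframe E i (cross_vect x y) = cross (c x) (c y) i.
Proof.
case: i => // i /= i7; rewrite /cross_vect /coframe /= coord_sum_free ?(basis_free bE) //.
by rewrite inordK.
Qed.

(** psi in coordinates, each monomial being expanded by Laplace along two rows. *)
Definition star_poly (X Y U V : nat -> R) : R :=
  let m i j k l :=
    plucker X Y i j * plucker U V k l - plucker X U i j * plucker Y V k l
    + plucker X V i j * plucker Y U k l + plucker Y U i j * plucker X V k l
    - plucker Y V i j * plucker X U k l + plucker U V i j * plucker X Y k l in
  m 1%N 2%N 3%N 4%N + m 1%N 2%N 5%N 6%N + m 1%N 3%N 6%N 7%N + m 1%N 4%N 5%N 7%N + m 2%N 3%N 5%N 7%N - m 2%N 4%N 6%N 7%N + m 3%N 4%N 5%N 6%N.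

Lemma G2_dualE x y u v : G2_dual E (args4 x y u v) = star_poly (c x) (c y) (c u) (c v).
Proof.
rewrite /G2_dual !fctE /= !monomial4E /star_poly /plucker /c; ring.
Qed.

Lemma star_poly_delta X Y i j : (0 < i < 8)%N -> (0 < j < 8)%N ->
  star_poly X Y (fun k => (k == i)%:R) (fun k => (k == j)%:R) = sigma X Y i j.
Proof.
case: i => [|[|[|[|[|[|[|[|i]]]]]]]] // _;
case: j => [|[|[|[|[|[|[|[|j]]]]]]]] // _;
rewrite /star_poly /sigma /plucker /=; ring.
Qed.

Lemma G2_dual_sigma x y i j : (0 < i < 8)%N -> (0 < j < 8)%N ->
  G2_dual E (args4 x y E`_i.-1 E`_j.-1) = sigma (c x) (c y) i j.
Proof.
move=> iP jP; rewrite G2_dualE -star_poly_delta //.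
have e k n : (0 < n < 8)%N -> (0 < k < 8)%N -> coframe E k E`_n.-1 = (k == n)%:R.
  by case: n => // n n7 k7; rewrite (coframe_nth (basis_free bE)).
by rewrite /star_poly /plucker /c !(e _ i) // !(e _ j).
Qed.

Lemma G2_dual_cross x y u : G2_dual E (args4 x y (cross_vect x y) u) = 0.
Proof.
rewrite G2_dualE /star_poly /plucker /c !coframe_cross // /cross /plucker /c /=; ring.
Qed.

Lemma G2_dual_comb a b x y u v :
  G2_dual E (args4 (a *: x + b *: y) x u v) = - b * G2_dual E (args4 x y u v).
Proof.
rewrite /G2_dual !fctE /= !monomial4E !coframeD !coframeZ; ring.
Qed.

Lemma G2_dual0 x y u : G2_dual E (args4 0 x y u) = 0.
Proof. rewrite /G2_dual !fctE /= !monomial4E !coframe0; ring. Qed.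

Lemma gram_neq0 x y : free [:: x; y] ->
  dot (c x) (c x) * dot (c y) (c y) - dot (c x) (c y) * dot (c x) (c y) != 0.
Proof.
move=> fxy; apply/negP => /eqP /gram_eq0 H.
have E1 : dot (c y) (c y) *: x = dot (c x) (c y) *: y.
  by apply: (coframe_inj bE) => i iP; rewrite !coframeZ; exact: H.
have y0 : dot (c y) (c y) = 0.
  apply/eqP/negPn/negP => yy.
  move: fxy; rewrite free_cons => /andP [/negP xy _]; apply: xy.
  rewrite span_seq1; apply/vlineP; exists ((dot (c y) (c y))^-1 * dot (c x) (c y)).
  by rewrite -scalerA -E1 scalerA mulVf // scale1r.
have : y != 0 by apply: (free_not0 fxy); rewrite !inE eqxx orbT.
move/eqP; apply; apply: (coframe_inj bE) => i iP; rewrite coframe0.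
exact: (dot_eq0 y0).
Qed.

Hypothesis psi_closed : ce_diff (G2_dual E) = 0.

(** This removes the y-component [w] of the bracket with z = x \times y; exchanging x and y will
    remove the other component. *)
Lemma cross_bracket x y : (forall u, lie_bracket x u = 0) ->
  (forall u v, lie_bracket u v \in <<[:: x; y]>>%VS) ->
  free [:: x; y] -> (forall u, lie_bracket y u = 0) ->
  forall u, lie_bracket (cross_vect x y) u \in <[x]>%VS.
Proof.
move=> xc D fxy yc; set z := cross_vect x y.
pose w u v := coord [tuple x; y] (inord 1) (lie_bracket u v).
pose w' u v := coord [tuple x; y] (inord 0) (lie_bracket u v).
have brE u v : lie_bracket u v = w' u v *: x + w u v *: y.
  rewrite {1}(@coord_span _ _ _ [tuple x; y] _ (D u v)) !big_ord_recl big_ord0 addr0 /=.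
  by rewrite /w /w'; do ![congr (_ + _) | congr (_ *: _) | congr (coord _ _ _)];
     apply: val_inj; rewrite /= inordK.
pose B i := w z E`_i.-1.
have wL u : linear (w u : g -> R^o).
  by move=> a v t; rewrite /w lieDr lieZr linearP.
have w0 u : w u 0 = 0 by rewrite /w lie0r linear0.
have wE u v : w u v = \sum_(i < 7) c v i.+1 * w u E`_i.
  have wD v1 v2 : w u (v1 + v2) = w u v1 + w u v2 by rewrite /w lieDr linearD.
  rewrite {1}(coord_basis bE (memvf v)).
  rewrite (big_morph (w u) wD (w0 u)); apply: eq_bigr => i _.
  by rewrite /w lieZr linearZ /c /coframe /= inord_val.
(* In d psi (x, z, u, v, t), terms bracketing x vanish as x is central, and terms bracketing two of
   u, v, t give multiples of psi (x, y, z, .) = 0. What remains is the wedge of w(z, .) with psi (x,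
   y, ., .). *)
have H u v t : w z u * G2_dual E (args4 x y v t) - w z v * G2_dual E (args4 x y u t)
    + w z t * G2_dual E (args4 x y u v) = 0.
  have : ce_diff (G2_dual E) (args5 x z u v t) = 0 by rewrite psi_closed.
  rewrite ce_diff4E /= !xc !G2_dual0 !brE !G2_dual_comb !G2_dual_cross => <-; ring.
have S i j (iP : (0 < i < 8)%N) (jP : (0 < j < 8)%N) := G2_dual_sigma x y iP jP.
pose X := c x; pose Y := c y.
have ordP (j : 'I_7) : (0 < j.+1 < 8)%N by rewrite /= ltnS ltn_ord.
have N0 := gram_neq0 fxy.
(* Contracting this wedge with sigma leaves the Gram determinant times B, because B vanishes on the
   central vectors x, y and on z itself. *)
have B0 i : (0 < i < 8)%N -> B i = 0.
  move=> iP; have := contraction_by_sigma X Y B iP.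
  rewrite big1 => [|j _].
    have -> : dot B X = 0.
      transitivity (w z x); last by rewrite /w lieC xc oppr0 linear0.
      by rewrite wE; apply: eq_bigr => j _; rewrite mulrC.
    have -> : dot B Y = 0.
      transitivity (w z y); last by rewrite /w lieC yc oppr0 linear0.
      by rewrite wE; apply: eq_bigr => j _; rewrite mulrC.
    have -> : dot B (cross X Y) = 0.
      transitivity (w z z); last by rewrite /w liexx linear0.
      by rewrite wE; apply: eq_bigr => j _; rewrite mulrC /c /z (coframe_cross _ _ (ordP j)).
    rewrite !mulr0 subrr !mulr0 !addr0 => /esym/eqP.
    by rewrite !mulf_eq0 (negbTE N0) pnatr_eq0 /= => /eqP.
  rewrite big1 // => k _; rewrite -(S _ _ (ordP j) (ordP k)) -(S _ _ iP (ordP k)) -(S _ _ iP (ordP j)).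
  by have := H E`_i.-1 E`_j E`_k; rewrite /B /= => ->; rewrite mulr0.
move=> u; rewrite brE [w z u]wE big1 => [|i _]; first by rewrite scale0r addr0 memvZ ?memv_line.
by rewrite -[w z _]/(B i.+1) (B0 _ (ordP i)) mulr0.
Qed.

Lemma derived_plane_center :
  (forall x y z : g, lie_bracket x (lie_bracket y z) = 0) ->
  \dim (lie_derived g) = 2%N -> ~ center_in_derived g.
Proof.
move=> nil d2 cen; have cenD := lie_derived_central nil.
have [x [y [Dxy fxy]]] : exists x y, lie_derived g = <<[:: x; y]>>%VS /\ free [:: x; y].
  have [X [sX bX]] : exists X : seq g, size X = 2%N /\ basis_of (lie_derived g) X.
    by exists (vbasis (lie_derived g)); split; [rewrite size_tuple | exact: vbasisP].
  case: X sX bX => [|x [|y [|]]] //= _ /andP [/eqP DE fxy].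
  by exists x, y.
have xD : x \in lie_derived g by rewrite Dxy memv_span // inE eqxx.
have yD : y \in lie_derived g by rewrite Dxy memv_span // !inE eqxx orbT.
have fyx : free [:: y; x] by rewrite (perm_free (Y := [:: x; y])) // (perm_catC [:: y] [:: x]).
have xc u : lie_bracket x u = 0 by rewrite lieC cenD // oppr0.
have yc u : lie_bracket y u = 0 by rewrite lieC cenD // oppr0.
have D u v : lie_bracket u v \in <<[:: x; y]>>%VS by rewrite -Dxy mem_lie_derived.
have D' u v : lie_bracket u v \in <<[:: y; x]>>%VS.
  by rewrite (eq_span (Y := [:: x; y])) // => t; rewrite !inE orbC.
have zE : cross_vect y x = - cross_vect x y.
  apply: (coframe_inj bE) => i iP; rewrite coframeN !coframe_cross //.
  by case: i iP => [|[|[|[|[|[|[|[|i]]]]]]]] // _; rewrite /cross /plucker /=; ring.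
(* The brackets with the cross product lie on the line of x and on that of y, hence vanish: it is
   central. *)
have zD : cross_vect x y \in lie_derived g.
  apply: cen => u; rewrite lieC; apply/eqP; rewrite oppr_eq0; apply/eqP.
  have /vlineP [a aE] := cross_bracket xc D fxy yc u.
  have /vlineP [b bE'] := cross_bracket yc D' fyx xc u.
  rewrite aE; move: bE'; rewrite zE lieNl aE => ab.
  have := fxy; rewrite free_cons span_seq1 => /andP [xy _].
  have [->|a0] := eqVneq a 0; first by rewrite scale0r.
  case/negP: xy; apply/vlineP; exists (- a^-1 * b).
  by rewrite -scalerA -ab scalerN scaleNr opprK scalerA mulVf // scale1r.
have := gram_neq0 fxy; rewrite -cross_norm.
have [a [b ab]] : exists a b, cross_vect x y = a *: x + b *: y.
  move: zD; rewrite Dxy (span_cons x) span_seq1 => /memv_addP [s /vlineP [a ->]].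
  by move=> [t /vlineP [b ->] ->]; exists a, b.
have [zx zy] := cross_orthogonal (c x) (c y).
have -> : dot (cross (c x) (c y)) (cross (c x) (c y)) =
    a * dot (cross (c x) (c y)) (c x) + b * dot (cross (c x) (c y)) (c y).
  rewrite /dot !mulr_sumr -big_split /=; apply: eq_bigr => i _.
  have iP : (0 < i.+1 < 8)%N by rewrite /= ltnS ltn_ord.
  rewrite -[X in _ * X = _](coframe_cross _ _ iP) ab coframeD !coframeZ /c; ring.
by rewrite zx zy !mulr0 addr0 eqxx.
Qed.

End DerivedPlane.

(** * Nets of skew forms in dimension four *)

Section SkewForms.
Variable R : realFieldType.
Implicit Types (A B C M N : 'M[R]_4) (x y v : 'rV[R]_4).

Definition ent M (i j : nat) : R := M (inord i) (inord j).

Definition skew_mx (a b c d e f : R) : 'M[R]_4 :=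
  \matrix_(i < 4, j < 4) match val i, val j with
  | 0, 1 => a | 0, 2 => b | 0, 3 => c | 1, 2 => d | 1, 3 => e | 2, 3 => f
  | 1, 0 => - a | 2, 0 => - b | 3, 0 => - c | 2, 1 => - d | 3, 1 => - e
  | 3, 2 => - f
  | _, _ => 0 end.

Definition skewsymmetric M := M^T = - M.

Lemma skewE M : skewsymmetric M -> M = skew_mx (ent M 0 1) (ent M 0 2) (ent M 0 3)
  (ent M 1 2) (ent M 1 3) (ent M 2 3).
Proof.
move=> sM; have s i j : M i j = - M j i.
  by move/matrixP/(_ j i): sM; rewrite !mxE.
have d i : M i i = 0 by have := s i i; lra.
apply/matrixP => -[[|[|[|[|i]]]] Hi] // [[|[|[|[|j]]]] Hj] //; rewrite mxE /= /ent;
  (rewrite s; congr (- _); congr (M _ _); apply: val_inj; rewrite /= inordK //) ||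
  (congr (M _ _); apply: val_inj; rewrite /= inordK //) ||
  (by rewrite -[RHS](d (Ordinal Hi)); congr (M _ _); apply: val_inj).
Qed.

(* The Hodge dual of M; polar M M is twice the Pfaffian of M. *)
Definition hat M := skew_mx (ent M 2 3) (- ent M 1 3) (ent M 1 2)
  (ent M 0 3) (- ent M 0 2) (ent M 0 1).

Definition polar M N : R :=
  ent M 0 1 * ent N 2 3 + ent N 0 1 * ent M 2 3
  - ent M 0 2 * ent N 1 3 - ent N 0 2 * ent M 1 3
  + ent M 0 3 * ent N 1 2 + ent N 0 3 * ent M 1 2.

Lemma ent_skew a b c d e f (M := skew_mx a b c d e f) :
  (ent M 0 1 = a) * (ent M 0 2 = b) * (ent M 0 3 = c) *
  (ent M 1 2 = d) * (ent M 1 3 = e) * (ent M 2 3 = f).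
Proof. by rewrite /ent /M !mxE /= !inordK. Qed.

Ltac mx4 := apply/matrixP => -[[|[|[|[|?]]]] ?] // [[|[|[|[|?]]]] ?] //;
  rewrite !mxE ?big_ord_recl ?big_ord0 ?mxE /=.

Lemma skew_skew_mx a b c d e f : skewsymmetric (skew_mx a b c d e f).
Proof. rewrite /skewsymmetric; mx4; ring. Qed.

Lemma skew_hat M : skewsymmetric (hat M). Proof. exact: skew_skew_mx. Qed.

(** The polarization of the identity that M times its Hodge dual is minus the Pfaffian of M. *)
Lemma mul_hat A B : skewsymmetric A -> skewsymmetric B ->
  A *m hat B + B *m hat A = - (polar A B)%:M.
Proof.
move=> /skewE -> /skewE ->; rewrite /hat /polar !ent_skew.
move: (ent A 0 1) (ent A 0 2) (ent A 0 3) (ent A 1 2) (ent A 1 3) (ent A 2 3) => a b c d e f.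
move: (ent B 0 1) (ent B 0 2) (ent B 0 3) (ent B 1 2) (ent B 1 3) (ent B 2 3) => a' b' c' d' e' f'.
mx4; ring.
Qed.

Lemma hat_mul A B : skewsymmetric A -> skewsymmetric B ->
  hat A *m B + hat B *m A = - (polar A B)%:M.
Proof.
move=> /skewE -> /skewE ->; rewrite /hat /polar !ent_skew.
move: (ent A 0 1) (ent A 0 2) (ent A 0 3) (ent A 1 2) (ent A 1 3) (ent A 2 3) => a b c d e f.
move: (ent B 0 1) (ent B 0 2) (ent B 0 3) (ent B 1 2) (ent B 1 3) (ent B 2 3) => a' b' c' d' e' f'.
mx4; ring.
Qed.

Lemma scale_skew_mx k a b c d e f : k *: skew_mx a b c d e f =
  skew_mx (k * a) (k * b) (k * c) (k * d) (k * e) (k * f).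
Proof. mx4; ring. Qed.

Lemma mul_flip (s t u w : R) : s * t = u * w -> w * u = t * s.
Proof. by move=> h; rewrite mulrC -h mulrC. Qed.

Ltac minor := first [exact: mulrC | assumption
  | apply: mul_flip; assumption].

Lemma hat_proportional A B : skewsymmetric A -> skewsymmetric B -> hat A *m B = 0 ->
  A != 0 -> exists a b, a != 0 /\ a *: B = b *: A.
Proof.
move=> sA sB; rewrite (skewE sA) (skewE sB) /hat !ent_skew.
move: (ent A 0 1) (ent A 0 2) (ent A 0 3) (ent A 1 2) (ent A 1 3) (ent A 2 3) => a b c d e f.
move: (ent B 0 1) (ent B 0 2) (ent B 0 3) (ent B 1 2) (ent B 1 3) (ent B 2 3) => a' b' c' d' e' f'.
move=> /matrixP H A0.
have E (i j : nat) : (i < 4)%N -> (j < 4)%N -> _ := fun i4 j4 => H (inord i) (inord j).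
have := (E 0 0 isT isT, E 0 1 isT isT, E 0 2 isT isT, E 0 3 isT isT,
  E 1 0 isT isT, E 1 1 isT isT, E 1 2 isT isT, E 1 3 isT isT)%N.
have := (E 2 0 isT isT, E 2 1 isT isT, E 2 2 isT isT, E 2 3 isT isT,
  E 3 0 isT isT, E 3 1 isT isT, E 3 2 isT isT, E 3 3 isT isT)%N.
rewrite !mxE !big_ord_recl !big_ord0 !mxE /= !inordK //= {E H}.
move=> [[[[[[[h1 h2] h3] h4] h5] h6] h7] h8] [[[[[[[h9 h10] h11] h12] h13] h14] h15] h16].
have lin (s t u : R) : u = 0 -> s - t = u \/ t - s = u -> s = t.
  by move=> -> [] /eqP; rewrite subr_eq0 => /eqP.
have de : d * e' = d' * e by apply: (lin _ _ _ h10); first [left; ring | right; ring].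
have df : d * f' = d' * f by apply: (lin _ _ _ h11); first [left; ring | right; ring].
have ef : e * f' = e' * f by apply: (lin _ _ _ h12); first [left; ring | right; ring].
have bc : b * c' = b' * c by apply: (lin _ _ _ h13); first [left; ring | right; ring].
have bf : b * f' = b' * f by apply: (lin _ _ _ h15); first [left; ring | right; ring].
have cf : c * f' = c' * f by apply: (lin _ _ _ h16); first [left; ring | right; ring].
have ac : a * c' = a' * c by apply: (lin _ _ _ h1); first [left; ring | right; ring].
have ae : a * e' = a' * e by apply: (lin _ _ _ h2); first [left; ring | right; ring].
have ce : c * e' = c' * e by apply: (lin _ _ _ h4); first [left; ring | right; ring].
have ab : a * b' = a' * b by apply: (lin _ _ _ h5); first [left; ring | right; ring].
have ad : a * d' = a' * d by apply: (lin _ _ _ h6); first [left; ring | right; ring].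
have bd : b * d' = b' * d by apply: (lin _ _ _ h7); first [left; ring | right; ring].
(* The off-diagonal entries of hat A *m B are single 2 x 2 minors of the two coordinate vectors. The
   minors pairing complementary entries occur only in combination, on the diagonal, and are
   recovered linearly. *)
have af : a * f' = a' * f by clear - h3 h8 h9 h14; lra.
have be : b * e' = b' * e by clear - h3 h8 h9 h14; lra.
have cd : c * d' = c' * d by clear - h3 h8 h9 h14; lra.
clear h1 h2 h3 h4 h5 h6 h7 h8 h9 h10 h11 h12 h13 h14 h15 h16 lin.
have [/eqP a0|a0] := boolP (a == 0); last first.
  by exists a, a'; rewrite !scale_skew_mx; split=> //; congr skew_mx; minor.
have [/eqP b0|b0] := boolP (b == 0); last first.
  by exists b, b'; rewrite !scale_skew_mx; split=> //; congr skew_mx; minor.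
have [/eqP c0|c0] := boolP (c == 0); last first.
  by exists c, c'; rewrite !scale_skew_mx; split=> //; congr skew_mx; minor.
have [/eqP d0|d0] := boolP (d == 0); last first.
  by exists d, d'; rewrite !scale_skew_mx; split=> //; congr skew_mx; minor.
have [/eqP e0|e0] := boolP (e == 0); last first.
  by exists e, e'; rewrite !scale_skew_mx; split=> //; congr skew_mx; minor.
have [/eqP f0|f0] := boolP (f == 0); last first.
  by exists f, f'; rewrite !scale_skew_mx; split=> //; congr skew_mx; minor.
case/negP: A0; apply/eqP; rewrite a0 b0 c0 d0 e0 f0; mx4; rewrite ?oppr0 //.
Qed.

End SkewForms.

Section SkewNets.
Variable R : realFieldType.
Implicit Types (A B C M N P T S : 'M[R]_4) (x y v : 'rV[R]_4).

Definition bil M x y : R := (x *m M *m y^T) 0 0.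

Lemma bilD M N x y : bil (M + N) x y = bil M x y + bil N x y.
Proof. by rewrite /bil mulmxDr mulmxDl mxE. Qed.

Lemma bilDl M x y v : bil M (x + y) v = bil M x v + bil M y v.
Proof. by rewrite /bil !mulmxDl mxE. Qed.

Lemma bilDr M x y v : bil M v (x + y) = bil M v x + bil M v y.
Proof. by rewrite /bil linearD /= mulmxDr mxE. Qed.

Lemma bilZ k M x y : bil (k *: M) x y = k * bil M x y.
Proof. by rewrite /bil -scalemxAr -scalemxAl mxE. Qed.

Lemma bilN M x y : bil (- M) x y = - bil M x y.
Proof. by rewrite /bil mulmxN mulNmx mxE. Qed.

Lemma bil_mul M x y T S : bil M (x *m T) (y *m S) = bil (T *m M *m S^T) x y.
Proof. by rewrite /bil trmx_mul !mulmxA. Qed.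

Lemma bil_tr M x y : bil M^T x y = bil M y x.
Proof.
rewrite /bil -[in RHS](trmxK (y *m M *m x^T)) [RHS]mxE.
by rewrite !trmx_mul trmxK mulmxA.
Qed.

Lemma bil_skew M x : skewsymmetric M -> bil M x x = 0.
Proof. by move=> sM; have := bil_tr M x x; rewrite sM bilN; lra. Qed.

Lemma bil_delta M i j : bil M (delta_mx 0 i) (delta_mx 0 j) = M i j.
Proof. by rewrite /bil trmx_delta -rowE -colE !mxE. Qed.

Lemma bil_symmetric_neq0 M : M^T = M -> M != 0 -> exists v, bil M v v != 0.
Proof.
move=> sM M0; apply: contrapT => H; case/negP: M0; apply/eqP/matrixP => i j.
have H0 v : bil M v v = 0 by apply/eqP/negPn/negP => Hv; apply: H; exists v.
have := H0 (delta_mx 0 i + delta_mx 0 j).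
rewrite bilDl !bilDr !H0 !bil_delta.
have -> : M j i = M i j by rewrite -[in RHS]sM mxE.
move=> Hs; rewrite mxE; lra.
Qed.

Definition stack (s : seq 'rV[R]_4) : 'M[R]_4 := \matrix_(i < 4) nth 0 s i.

Lemma ent_congr M s i j : (i < 4)%N -> (j < 4)%N ->
  ent (stack s *m M *m (stack s)^T) i j = bil M (nth 0 s i) (nth 0 s j).
Proof.
by move=> i4 j4; rewrite /ent -bil_delta -bil_mul -!rowE !rowK !inordK.
Qed.

Lemma skew_unit M : skewsymmetric M -> polar M M != 0 -> M \in unitmx.
Proof.
move=> sM p0; have := mul_hat sM sM; rewrite -mulr2n -scaler_nat => H.
suff /mulmx1_unit [] : M *m (- (2 / polar M M) *: hat M) = 1%:M by [].
rewrite -scalemxAr scaleNr -[hat M in LHS]scale1r.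
have -> : M *m (1 *: hat M) = - (polar M M / 2)%:M.
  rewrite scale1r; apply: (scalerI (a := 2%:R)); first by rewrite pnatr_eq0.
  by rewrite H scalerN scale_scalar_mx; congr (- _%:M); field.
by rewrite scalerN opprK scale_scalar_mx; congr (_%:M); field.
Qed.

(** The conditions of [net_relations] on one component of the bracket, with indices counted from
    0. *)
Definition net_mx a b M : Prop :=
  [/\ ent M 0 3 = ent M 1 2, ent M 1 3 = a * ent M 0 2 & ent M 2 3 = - b * ent M 0 1].

End SkewNets.

Section SkewNetNormalForms.
Variable R : realFieldType.
Implicit Types (A B C M N P T S : 'M[R]_4) (x y v : 'rV[R]_4).

(** Since hat A is - (p / 2) times the inverse of A, orthogonality to A makes T = B A^-1 and S = C
    A^-1 multiples of A *m hat B and A *m hat C. The Hodge identities then give T^2 = a, S^2 = b and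
    ST = - TS, and both are self-adjoint for A. *)
Lemma net_nondegenerate A B C :
  skewsymmetric A -> skewsymmetric B -> skewsymmetric C ->
  polar A A != 0 -> polar A B = 0 -> polar A C = 0 -> polar B C = 0 ->
  (forall b c : R, b *: B + c *: C = 0 -> b = 0 /\ c = 0) ->
  exists P a b, P \in unitmx /\
    [/\ net_mx a b (P *m A *m P^T), net_mx a b (P *m B *m P^T)
      & net_mx a b (P *m C *m P^T)].
Proof.
move=> sA sB sC p0 AB AC BC ind; set p := polar A A in p0.
have uA : A \in unitmx := skew_unit sA p0.
pose K := invmx A; have AK : A *m K = 1%:M := mulmxV uA.
have KA : K *m A = 1%:M := mulVmx uA.
have hatK M : skewsymmetric M -> polar A M = 0 -> A *m hat M = (p / 2) *: (M *m K).
  move=> sM pM; have := mul_hat sA sM; rewrite pM raddf0 oppr0 => /eqP.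
  rewrite addr_eq0 => /eqP ->.
  have -> : hat A = - (p / 2) *: K.
    have H2 : A *m hat A = - (p / 2)%:M.
      apply: (scalerI (a := 2%:R)); first by rewrite pnatr_eq0.
      rewrite scaler_nat mulr2n (mul_hat sA sA) scalerN scale_scalar_mx.
      by congr (- _%:M); rewrite -/p; field.
    by rewrite -[LHS]mul1mx -KA -mulmxA H2 mulmxN mul_mx_scalar scaleNr.
  by rewrite -scalemxAr scaleNr opprK.
pose T := B *m K; pose S := C *m K.
have TA : T *m A = B by rewrite /T -mulmxA KA mulmx1.
have SA : S *m A = C by rewrite /S -mulmxA KA mulmx1.
have AT : A *m T^T = T *m A.
  by have := congr1 trmx TA; rewrite trmx_mul sA sB mulNmx => /oppr_inj ->; rewrite TA.
have AS : A *m S^T = S *m A.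
  by have := congr1 trmx SA; rewrite trmx_mul sA sC mulNmx => /oppr_inj ->; rewrite SA.
have hatT : T = (2 / p) *: (A *m hat B).
  by rewrite hatK // scalerA (_ : 2 / p * (p / 2) = 1) ?scale1r //; field.
have hatS : S = (2 / p) *: (A *m hat C).
  by rewrite hatK // scalerA (_ : 2 / p * (p / 2) = 1) ?scale1r //; field.
have sqr M : skewsymmetric M -> hat M *m M = - (polar M M / 2)%:M.
  move=> sM; apply: (scalerI (a := 2%:R)); first by rewrite pnatr_eq0.
  rewrite scaler_nat mulr2n (hat_mul sM sM) scalerN scale_scalar_mx.
  by congr (- _%:M); field.
pose a := - (polar B B / p); pose b := - (polar C C / p).
have TT : T *m T = a%:M.
  rewrite {1}hatT /T -scalemxAl mulmxA -(mulmxA A) sqr // mulmxN mulNmx mul_mx_scalar.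
  rewrite -scalemxAl AK scalerN scalerA scale_scalar_mx mulr1 -raddfN; congr (_%:M).
  by rewrite /a; field.
have SS : S *m S = b%:M.
  rewrite {1}hatS /S -scalemxAl mulmxA -(mulmxA A) sqr // mulmxN mulNmx mul_mx_scalar.
  rewrite -scalemxAl AK scalerN scalerA scale_scalar_mx mulr1 -raddfN; congr (_%:M).
  by rewrite /b; field.
have ST : S *m T = - (T *m S).
  apply/eqP; rewrite -addr_eq0; apply/eqP.
  rewrite {1}hatS {2}hatT {1}/T {1}/S -!scalemxAl -scalerDr !mulmxA -!(mulmxA A) -mulmxDr.
  by rewrite -mulmxDl addrC hat_mul // BC raddf0 oppr0 mul0mx mulmx0 scaler0.
(* Otherwise hat B *m C = 0, which would make B and C proportional. *)
have TS0 : T *m S *m A != 0.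
  apply/negP => /eqP H.
  have {}H : hat B *m C = 0.
    have : K *m (T *m S *m A) = 0 by rewrite H mulmx0.
    rewrite -mulmxA SA hatT -scalemxAl -scalemxAr !mulmxA KA mul1mx => /eqP.
    by rewrite scaler_eq0 mulf_eq0 invr_eq0 (negbTE p0) pnatr_eq0 /= => /eqP.
  have [B0|B0] := eqVneq B 0.
    have E0 : 1 *: B + 0 *: C = 0 by rewrite B0 scaler0 scale0r addr0.
    by have [/eqP] := ind _ _ E0; rewrite oner_eq0.
  have [k [m [k0 E]]] := hat_proportional sB sC H B0.
  have E0 : - m *: B + k *: C = 0 by rewrite E scaleNr addNr.
  by have [_ k00] := ind _ _ E0; rewrite k00 eqxx in k0.
clearbody T S.
(* TSA is symmetric, because S and T anticommute and are self-adjoint for the skew form A. *)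
have [|v v0] := bil_symmetric_neq0 _ TS0.
  by rewrite !trmx_mul sA mulNmx mulmxA AS -(mulmxA S) AT mulmxA ST mulNmx opprK.
pose P := stack [:: v; v *m T; v *m S; v *m (S *m T)].
exists P, a, b.
have bA : bil A v v = 0 := bil_skew v sA.
have bB : bil (T *m A) v v = 0 by rewrite TA bil_skew.
have bC : bil (S *m A) v v = 0 by rewrite SA bil_skew.
have rS X : S *m (T *m X) = - (T *m (S *m X)) by rewrite !mulmxA ST mulNmx.
have rT X : T *m (T *m X) = a *: X by rewrite mulmxA TT mul_scalar_mx.
have rSS X : S *m (S *m X) = b *: X by rewrite mulmxA SS mul_scalar_mx.
have rA X : A *m (T^T *m X) = T *m (A *m X) by rewrite mulmxA AT mulmxA.
have rA' X : A *m (S^T *m X) = S *m (A *m X) by rewrite mulmxA AS mulmxA.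
have sc k (X Y : 'M[R]_4) : X *m (k *: Y) = k *: (X *m Y) by rewrite scalemxAr.
have simp := (rS, rT, rSS, rA, rA', AT, AS, mulmxN, sc, TT, SS).
have E X i j : (i < 4)%N -> (j < 4)%N -> ent (P *m X *m P^T) i j =
    bil (nth 0 [:: 1%:M; T; S; S *m T] i *m X *m (nth 0 [:: 1%:M; T; S; S *m T] j)^T) v v.
  move=> i4 j4; rewrite -bil_mul ent_congr //.
  have nE n : (n < 4)%N -> nth 0 [:: v; v *m T; v *m S; v *m (S *m T)] n =
     v *m nth 0 [:: 1%:M; T; S; S *m T] n by case: n => [|[|[|[|n]]]] //= _; rewrite mulmx1.
  by rewrite !nE.
have net M : (M = A) \/ (M = T *m A) \/ (M = S *m A) -> net_mx a b (P *m M *m P^T).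
  move=> [->|[->|->]]; split; rewrite !E //= ?trmx1 ?mulmx1 ?mul1mx !trmx_mul -!mulmxA;
  rewrite ?simp ?(bilN, bilZ) ?bA ?bB ?bC; ring.
split; last by split; apply: net; rewrite -?TA -?SA; auto.
pose M := P *m A *m P^T.
have sM : skewsymmetric M by rewrite /skewsymmetric !trmx_mul trmxK sA mulNmx mulmxN mulmxA.
suff : M \in unitmx by rewrite !unitmx_mul => /andP [/andP []].
(* In the new vectors the entries 03 and 12 of A both equal the value of TSA on v, and 01 and 02
   vanish, so [polar M M] is twice the square of that value. *)
apply: (skew_unit sM).
have e01 : ent M 0 1 = 0.
  by rewrite E //= ?trmx1 ?mulmx1 ?mul1mx ?trmx_mul -?mulmxA ?simp ?bB.
have e02 : ent M 0 2 = 0.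
  by rewrite E //= ?trmx1 ?mulmx1 ?mul1mx ?trmx_mul -?mulmxA ?simp ?bC.
have e12 : ent M 1 2 = bil (T *m S *m A) v v.
  by rewrite E //= ?trmx1 ?mulmx1 ?mul1mx ?trmx_mul -?mulmxA ?simp.
have [e03 _ _] := net A (or_introl erefl); rewrite -/M in e03.
have -> : polar M M = 2 * (bil (T *m S *m A) v v * bil (T *m S *m A) v v).
  by rewrite /polar e01 e02 e03 e12; ring.
by rewrite !mulf_eq0 (negbTE v0) pnatr_eq0.
Qed.

(* hat M *m h = 0 says that h /\ M = 0. *)
Lemma skew_factor M (h : 'cV[R]_4) : skewsymmetric M -> h != 0 -> hat M *m h = 0 ->
  exists f : 'cV[R]_4, M = h *m f^T - f *m h^T.
Proof.
move=> sM h0 H.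
have [i hi] : exists i, h i 0 != 0.
  apply: contrapT => N; case/negP: h0; apply/eqP/matrixP => i j; rewrite ord1 mxE.
  by apply/eqP/negPn/negP => hi; apply: N; exists i.
exists (((h i 0)^-1 *: row i M)^T).
apply: (scalerI hi); apply/matrixP => j k.
rewrite !mxE !big_ord1 !mxE.
have -> : h i 0 * (h j 0 * ((h i 0)^-1 * M i k) - (h i 0)^-1 * M i j * h k 0) =
  h j 0 * M i k - M i j * h k 0 by field.
move: H; rewrite (skewE sM) /hat !ent_skew.
move: (ent M 0 1) (ent M 0 2) (ent M 0 3) (ent M 1 2) (ent M 1 3) (ent M 2 3) => a b c d e f.
move=> /matrixP H.
have E (n : nat) : (n < 4)%N -> _ := fun n4 => H (inord n) 0.
have := (E 0 isT, E 1 isT, E 2 isT, E 3 isT)%N.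
rewrite !mxE !big_ord_recl !big_ord0 !mxE /= !inordK //= {E H hi sM}.
pose u n := h (inord n) 0.
have hE (n : 'I_4) : h n 0 = u n by rewrite /u inord_val.
rewrite !hE /= /bump /= => -[[[h1 h2] h3] h4].
case: i j k => [[|[|[|[|i]]]] Hi] // [[|[|[|[|j]]]] Hj] // [[|[|[|[|k]]]] Hk] //=; lra.
Qed.

End SkewNetNormalForms.

Section DegenerateNets.
Variable R : realFieldType.
Implicit Types (A B C M N P : 'M[R]_4) (g h u : 'cV[R]_4).

Definition free_mx A B : Prop := forall a b : R, a *: A + b *: B = 0 -> a = 0 /\ b = 0.

Lemma outer_eq0 u h : u *m h^T = 0 -> h != 0 -> u = 0.
Proof.
move=> /matrixP uh h0; apply/matrixP => i j; rewrite ord1 mxE.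
apply/eqP/negPn/negP => ui; case/negP: h0; apply/eqP/matrixP => k l.
have := uh i k; rewrite [LHS]mxE big_ord1 !mxE => /eqP.
by rewrite mulf_eq0 (negbTE ui) /= => /eqP <-; rewrite ord1.
Qed.

Lemma hat_mulxx M : skewsymmetric M -> polar M M = 0 -> hat M *m M = 0 /\ M *m hat M = 0.
Proof.
move=> sM p0; split; apply: (scalerI (a := 2%:R)); rewrite ?pnatr_eq0 // scaler0;
  by rewrite scaler_nat mulr2n ?hat_mul ?mul_hat // p0 raddf0 oppr0.
Qed.

(** In the rank factorization of a single column, the inverse of the left factor sends the column to
    a multiple of the first unit vector. *)
Lemma column_to_first g : exists2 P, P \in unitmx & forall i, (0 < i)%N ->
  (i < 4)%N -> (P *m g) (inord i) 0 = 0.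
Proof.
exists (invmx (col_ebase g)); first by rewrite unitmx_inv col_ebase_unit.
move=> i i0 i4; rewrite -{2}(mulmx_ebase g) -mulmxA mulKmx ?col_ebase_unit //.
by rewrite !mxE big_ord1 !mxE inordK // (gtn_eqF i0) mul0r.
Qed.

(* Any nonzero column of A *m hat B is a common factor of A and B.            *)
Lemma net_degenerate A B C :
  skewsymmetric A -> skewsymmetric B -> skewsymmetric C ->
  polar A A = 0 -> polar B B = 0 -> polar C C = 0 ->
  polar A B = 0 -> polar A C = 0 -> polar B C = 0 -> free_mx A B ->
  (forall x : 'rV[R]_4, x *m A = 0 -> x *m B = 0 -> x *m C = 0 -> x = 0) ->
  exists2 P, P \in unitmx & forall M, M \in [:: A; B; C] ->
    [/\ ent (P *m M *m P^T) 1 2 = 0, ent (P *m M *m P^T) 1 3 = 0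
      & ent (P *m M *m P^T) 2 3 = 0].
Proof.
move=> sA sB sC AA BB CC AB AC BC ind ker.
have [hAA AhA] := hat_mulxx sA AA; have [hBB BhB] := hat_mulxx sB BB.
have [hCC ChC] := hat_mulxx sC CC.
have anti M N : skewsymmetric M -> skewsymmetric N -> polar M N = 0 ->
    hat M *m N = - (hat N *m M) /\ M *m hat N = - (N *m hat M).
  move=> sM sN p0; split; apply/eqP; rewrite -addr_eq0.
    by rewrite hat_mul // p0 raddf0 oppr0.
  by rewrite mul_hat // p0 raddf0 oppr0.
have [hAB AhB] := anti A B sA sB AB; have [hAC AhC] := anti A C sA sC AC.
have [hBC BhC] := anti B C sB sC BC.
have A0 : A != 0.
  apply/negP => /eqP A0; have E0 : 1 *: A + 0 *: B = 0 by rewrite A0 scaler0 scale0r addr0.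
  by have [/eqP] := ind _ _ E0; rewrite oner_eq0.
have hAB0 : hat A *m B != 0.
  apply/negP => /eqP H; have [k [m [k0 E]]] := hat_proportional sA sB H A0.
  have E0 : - m *: A + k *: B = 0 by rewrite E scaleNr addNr.
  by have [_ k00] := ind _ _ E0; rewrite k00 eqxx in k0.
have AhB0 : A *m hat B != 0.
  rewrite AhB oppr_eq0; apply: contra hAB0 => /eqP H.
  by rewrite -[_ *m _]trmxK trmx_mul sB (skew_hat A) mulmxN mulNmx opprK H trmx0.
have [j gj] : exists j, (A *m hat B) *m delta_mx j (0 : 'I_1) != 0.
  apply: contrapT => N; case/negP: AhB0; apply/eqP/matrixP => i j.
  have : col j (A *m hat B) = 0.
    by rewrite colE; apply/eqP/negPn/negP => hi; apply: N; exists j.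
  by move/matrixP/(_ i 0); rewrite !mxE.
set g := _ *m _ in gj.
have hAg : hat A *m g = 0 by rewrite /g !mulmxA hAA !mul0mx.
have hBg : hat B *m g = 0.
  by rewrite /g !mulmxA -[hat B *m A]opprK -hAB !mulNmx -(mulmxA _ B) BhB mulmx0 mul0mx oppr0.
clearbody g.
have [fA fAE] := skew_factor sA gj hAg.
have [fB fBE] := skew_factor sB gj hBg.
(* Dividing B by the factor g shows that hat A *m B is the rank-one matrix - k g^T; this k lies in
   the kernels of A and B. *)
pose k := hat A *m fB.
have kE : hat A *m B = - (k *m g^T).
  by rewrite {1}fBE mulmxBr !mulmxA hAg mul0mx sub0r.
have k0 : k != 0.
  by apply: contra hAB0 => /eqP k0; rewrite kE k0 mul0mx oppr0.
have hBf : hat B *m fB = 0.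
  apply: (outer_eq0 _ gj); have := hBB; rewrite {2}fBE mulmxBr !mulmxA hBg mul0mx sub0r.
  by move/eqP; rewrite oppr_eq0 => /eqP.
have Ak : A *m k = 0 by rewrite /k mulmxA AhA mul0mx.
have Bk : B *m k = 0.
  by rewrite /k mulmxA -[B *m hat A]opprK -AhB mulNmx -mulmxA hBf mulmx0 oppr0.
clearbody k.
(* If g did not divide C, the nonzero vector k would also be in the kernel of C, against the absence
   of a common kernel. *)
have [hCg|hCg] := eqVneq (hat C *m g) 0; last first.
  have Ck : C *m k = 0.
    apply: (outer_eq0 _ hCg); rewrite trmx_mul (skew_hat C) !mulmxN mulmxA -(mulmxA C k).
    have -> : k *m g^T = - (hat A *m B) by rewrite kE opprK.
    rewrite mulmxN mulNmx opprK -!mulmxA BhC mulmxN mulmxN (mulmxA (hat A) C) hAC mulNmx.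
    by rewrite mulmxN opprK !mulmxA ChC !mul0mx.
  case/negP: k0; apply/eqP; rewrite -[k]trmxK; apply/eqP; rewrite trmx_eq0; apply/eqP.
  have tr M : skewsymmetric M -> M *m k = 0 -> k^T *m M = 0.
    by move=> sM Mk; rewrite -[_ *m _]trmxK trmx_mul sM trmxK mulNmx Mk oppr0 trmx0.
  by apply: ker; apply: tr.
have [fC fCE] := skew_factor sC gj hCg.
have [P uP Pg] := column_to_first g.
exists P => // M MABC.
have [f ->] : exists f, M = g *m f^T - f *m g^T.
  by move: MABC; rewrite !inE => /or3P [] /eqP ->; [exists fA | exists fB | exists fC].
have E i l : (0 < i < 4)%N -> (0 < l < 4)%N ->
    ent (P *m (g *m f^T - f *m g^T) *m P^T) i l = 0.
  move=> /andP [i0 i4] /andP [l0 l4].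
  have -> : P *m (g *m f^T - f *m g^T) *m P^T =
      (P *m g) *m (P *m f)^T - (P *m f) *m (P *m g)^T.
    by rewrite !trmx_mul mulmxBr mulmxBl !mulmxA.
  rewrite /ent [LHS]mxE [X in X + _]mxE [X in _ + X]mxE [X in _ - X]mxE !big_ord1.
  by rewrite [(P *m g)^T _ _]mxE !Pg // mul0r mulr0 subr0.
by split; apply: E.
Qed.

End DegenerateNets.

(** * Orthogonal bases for a symmetric bilinear form *)

Section OrthogonalBasis.
Variables (R : realFieldType) (vT : vectType R) (b : vT -> vT -> R).
Hypothesis bL : forall u, linear (b u : vT -> R^o).
Hypothesis bC : forall u v, b u v = b v u.

HB.instance Definition _ u := GRing.isLinear.Build R vT R^o _ (b u : vT -> R^o) (bL u).

Lemma pairwise_in (T : eqType) (r : rel T) (s : seq T) :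
  (forall x y, x \in s -> y \in s -> r x y) -> pairwise r s.
Proof.
elim: s => //= x s IH H; apply/andP; split.
  by apply/allP => y ys; apply: H; rewrite !inE ?eqxx ?ys ?orbT.
by apply: IH => y z ys zs; apply: H; rewrite inE ?ys ?zs orbT.
Qed.

(** Induction on the dimension, splitting off an anisotropic vector as long as there is one. It is
    put at the head of the basis, so the head is anisotropic unless the form is zero on U. *)
Lemma orthogonal_basis (U : {vspace vT}) : exists X : seq vT,
  [/\ basis_of U X, pairwise (fun u v => b u v == 0) X &
      (forall u v, u \in U -> v \in U -> b u v = 0) \/ b (head 0 X) (head 0 X) != 0].
Proof.
have b0 u : b u 0 = 0 by have [] := linear_formE (bL u).
have bZ u a v : b u (a *: v) = a * b u v by have [] := linear_formE (bL u).
have bD u v w : b u (v + w) = b u v + b u w by have [] := linear_formE (bL u).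
move En : (\dim U) => n; elim: n U En => [|n IH] U En.
  have -> : U = 0%VS by apply/eqP; rewrite -dimv_eq0 En.
  exists [::]; split=> //; first exact: nil_basis.
  by left=> u v _; rewrite memv0 => /eqP ->.
have [H|H] := pselect (forall u, u \in U -> b u u = 0).
  have H0 u v : u \in U -> v \in U -> b u v = 0.
    move=> uU vU; have := H _ (memvD uU vU).
    rewrite bD [b (u + v) u]bC [b (u + v) v]bC !bD !H // [b v u]bC; lra.
  exists (vbasis U); split; [exact: vbasisP | | by left].
  by apply: pairwise_in => u v /vbasis_mem uU /vbasis_mem vU; rewrite H0.
have [u uU u0] : exists2 u, u \in U & b u u != 0.
  by apply: contrapT => N; apply: H => u uU; apply/eqP/negPn/negP => u0; apply: N; exists u.
pose f := linfun (b u : vT -> R^o).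
have kerE v : (v \in lker f) = (b u v == 0) by rewrite memv_ker lfunE.
pose U' := (U :&: lker f)%VS.
have dec v : v \in U -> exists2 w, w \in U' & v = (b u v / b u u) *: u + w.
  move=> vU; exists (v - (b u v / b u u) *: u); last by rewrite addrC subrK.
  rewrite memv_cap kerE memvB ?memvZ //= -scaleN1r bD !bZ.
  by apply/eqP; field.
have uU' : u \notin U' by rewrite memv_cap kerE (negbTE u0) andbF.
have UE : U = (<[u]> + U')%VS.
  apply/eqP; rewrite eqEsubv; apply/andP; split.
    apply/subvP => v /dec [w wU' ->]; apply: memv_add => //.
    by rewrite memvZ // memv_line.
  by rewrite subv_add -memvE uU capvSl.
have dU' : \dim U' = n.
  have U0 : (<[u]> :&: U')%VS = 0%VS.
    apply/eqP; rewrite -subv0; apply/subvP => v.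
    rewrite memv_cap => /andP [/vlineP [k ->]]; rewrite memv_cap kerE bZ => /andP [_].
    by rewrite mulf_eq0 (negbTE u0) orbF => /eqP ->; rewrite scale0r mem0v.
  have nz : u != 0 by apply: contraNneq u0 => ->; rewrite b0.
  by have := dimv_disjoint_sum U0; rewrite -UE En dim_vline nz => -[].
have [X [bX pX _]] := IH _ dU'.
have XU' v : v \in X -> v \in U' by exact: basis_mem bX.
exists (u :: X); split; last by right.
  rewrite basisEdim span_cons (span_basis bX) -UE subvv /= En.
  by have := size_basis (X := in_tuple X) bX; rewrite dU' => <-.
rewrite /= pX andbT; apply/allP => v /XU'.
by rewrite memv_cap kerE => /andP [].
Qed.

End OrthogonalBasis.

Section NetTheorem.
Variable R : realFieldType.
Implicit Types (A B C M N P : 'M[R]_4) (W : {vspace 'M[R]_4}).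

Lemma ent_congr_linear P i j k M N :
  ent (P *m (k *: M + N) *m P^T) i j =
  k * ent (P *m M *m P^T) i j + ent (P *m N *m P^T) i j.
Proof. by rewrite /ent mulmxDr mulmxDl -scalemxAr -scalemxAl !mxE. Qed.

Lemma polar_linear M : linear (polar M : 'M[R]_4 -> R^o).
Proof. by move=> k B C; rewrite /polar /ent !mxE -![_ *: _]/(_ * _); ring. Qed.

Lemma polarC M N : polar M N = polar N M.
Proof. by rewrite /polar; ring. Qed.

Definition net_mx0 M : Prop := [/\ ent M 1 2 = 0, ent M 1 3 = 0 & ent M 2 3 = 0].

(** The head of a basis orthogonal for the Pfaffian decides between [net_nondegenerate] and
    [net_degenerate]; both conclusions are linear in M and extend from the basis to W. *)
Lemma skew_net_normal_form W : \dim W = 3%N ->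
  (forall M, M \in W -> skewsymmetric M) ->
  (forall x : 'rV[R]_4, (forall M, M \in W -> x *m M = 0) -> x = 0) ->
  exists2 P, P \in unitmx &
    (exists a b, forall M, M \in W -> net_mx a b (P *m M *m P^T)) \/
    (forall M, M \in W -> net_mx0 (P *m M *m P^T)).
Proof.
move=> dW sW kW.
have [X [bX oX zX]] := orthogonal_basis polar_linear polarC W.
have sX : size X = 3%N by have := size_basis (X := in_tuple X) bX; rewrite dW => <-.
case: X sX bX oX zX => [|A [|B [|C [|D X]]]] //= _ bX.
rewrite !andbT => /andP [/andP [/eqP AB /eqP AC] /eqP BC] zX.
have [AW BW CW] : [/\ A \in W, B \in W & C \in W].
  by split; apply: (basis_mem bX); rewrite !inE eqxx ?orbT.
have [[sA sB] sC] := (sW _ AW, sW _ BW, sW _ CW).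
have ind (a b c : R) : a *: A + b *: B + c *: C = 0 -> [/\ a = 0, b = 0 & c = 0].
  move=> H; have /freeP := basis_free (bX : basis_of W [tuple A; B; C]).
  move=> /(_ (fun i => nth 0 [:: a; b; c] i)) K.
  have {}K : forall i : 'I_3, [:: a; b; c]`_i = 0.
    by apply: K; rewrite !big_ord_recl big_ord0 /= addr0 addrA.
  by split; [exact: (K ord0) | exact: (K (@Ordinal 3 1 isT)) | exact: (K (@Ordinal 3 2 isT))].
have dec M : M \in W -> exists a b c : R, M = a *: A + (b *: B + (c *: C + 0)).
  rewrite -(span_basis bX) => MW.
  rewrite (@coord_span _ _ _ [tuple A; B; C] _ MW) !big_ord_recl big_ord0 /=.
  by do 3 eexists.
have E0 P i j : ent (P *m 0 *m P^T) i j = 0 by rewrite mulmx0 mul0mx /ent mxE.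
case: zX => [zX|A0].
  have ind2 : free_mx A B.
    by move=> a b ab; have [] := ind a b 0 _; rewrite ?scale0r ?addr0.
  have ker (x : 'rV[R]_4) : x *m A = 0 -> x *m B = 0 -> x *m C = 0 -> x = 0.
    move=> xA xB xC; apply: kW => M /dec [a [b [c ->]]].
    by rewrite !mulmxDr -!scalemxAr xA xB xC mulmx0 !scaler0 !addr0.
  have [P uP H] := net_degenerate sA sB sC (zX _ _ AW AW) (zX _ _ BW BW)
    (zX _ _ CW CW) AB AC BC ind2 ker.
  exists P => //; right=> M /dec [a [b [c ->]]].
  have [|a1 a2 a3] := H A; first by rewrite !inE eqxx.
  have [|b1 b2 b3] := H B; first by rewrite !inE eqxx orbT.
  have [|c1 c2 c3] := H C; first by rewrite !inE eqxx !orbT.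
  by split; rewrite !ent_congr_linear E0 ?a1 ?a2 ?a3 ?b1 ?b2 ?b3 ?c1 ?c2 ?c3; ring.
have ind2 (b c : R) : b *: B + c *: C = 0 -> b = 0 /\ c = 0.
  by move=> bc; have [] := ind 0 b c _; rewrite ?scale0r ?add0r.
have [P [a [b [uP [[a1 a2 a3] [b1 b2 b3] [c1 c2 c3]]]]]] :=
  net_nondegenerate sA sB sC A0 AB AC BC ind2.
exists P => //; left; exists a, b => M /dec [k1 [k2 [k3 ->]]].
by split; rewrite !ent_congr_linear !E0 ?a1 ?a2 ?a3 ?b1 ?b2 ?b3 ?c1 ?c2 ?c3; ring.
Qed.

End NetTheorem.

(** * Three-dimensional derived algebra *)

Section DerivedThree.
Variables (R : rcfType) (g : lieAlgType R).
Hypothesis d7 : \dim (@fullv R g) = 7%N.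
Hypothesis nil : forall x y z : g, lie_bracket x (lie_bracket y z) = 0.
Hypothesis d3 : \dim (lie_derived g) = 3%N.
Hypothesis cen : center_in_derived g.

Lemma label_of_derived3 : exists l (F : 7.-tuple g), label_basis l F.
Proof.
have cenD := lie_derived_central nil.
have [v bv] : exists v : 4.-tuple g, basis_of (lie_derived g)^C v.
  have d4 : \dim (lie_derived g)^C = 4%N by rewrite dimv_compl d7 d3.
  have := vbasisP (lie_derived g)^C; move: (vbasis _); rewrite d4 => v bv.
  by exists v.
have [Z bZ] : exists Z : 3.-tuple g, basis_of (lie_derived g) Z.
  have := vbasisP (lie_derived g); move: (vbasis _); rewrite d3 => Z bZ.
  by exists Z.
pose br (p q : 'rV[R]_4) := lie_bracket (\sum_i p 0 i *: v`_i) (\sum_i q 0 i *: v`_i).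
pose m (l : 'I_3) : 'M[R]_4 := \matrix_(i, j) coord Z l (lie_bracket v`_i v`_j).
have mE p q l : coord Z l (br p q) = bil (m l) p q.
  rewrite /br lie_suml linear_sum /bil mxE /=; under [RHS]eq_bigr do rewrite mxE.
  under eq_bigr => i _ do rewrite lieZl lie_sumr scaler_sumr linear_sum /=.
  rewrite exchange_big /=; apply: eq_bigr => j _; rewrite mulr_suml.
  by apply: eq_bigr => i _; rewrite lieZr !linearZ /= !mxE; ring.
have brZ p q : br p q = \sum_l bil (m l) p q *: Z`_l.
  rewrite [LHS](coord_basis bZ (mem_lie_derived _ _)).
  by apply: eq_bigr => l _; rewrite mE.
have dec x : exists p : 'rV[R]_4, exists2 e, e \in lie_derived g &
    x = \sum_i p 0 i *: v`_i + e.
  have : x \in ((lie_derived g)^C + lie_derived g)%VS by rewrite addvC addv_complf memvf.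
  move=> /memv_addP [t tV [e eD ->]]; rewrite (coord_basis bv tV).
  exists (\row_i coord v i t), e => //; congr (_ + _).
  by apply: eq_bigr => i _; rewrite mxE.
have tE (l : 'I_3) : [tuple m l | l < 3]`_l = m l by rewrite -tnth_nth tnth_mktuple.
pose W := <<[tuple m l | l < 3]>>%VS.
have mW l : m l \in W.
  by apply: memv_span; apply/tnthP; exists l; rewrite tnth_mktuple.
(* A linear relation between the component matrices is a functional vanishing on all brackets, hence
   on D, so its coefficients are zero. *)
have dW : \dim W = 3%N.
  suff fm : free [tuple m l | l < 3] by rewrite (eqP (fm : _ == _)) size_tuple.
  apply/freeP => k k0.
  pose phi : g -> R^o := fun x => \sum_l k l * coord Z l x.
  have phiL : linear phi.
    move=> a x y; rewrite /phi -[X in _ = X]/(a * phi x + phi y) /phi mulr_sumr -big_split /=.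
    by apply: eq_bigr => l _; rewrite linearP /=; ring.
  pose f : {linear g -> R^o} := HB.pack phi (GRing.isLinear.Build _ _ _ _ phi phiL).
  have Dphi : (lie_derived g <= lker (linfun f))%VS.
    apply: lie_derived_min => x y; rewrite memv_ker lfunE /=.
    have [p [e eD ->]] := dec x; have [q [e' e'D ->]] := dec y.
    rewrite lieDr (cenD e') // addr0 lieDl [lie_bracket e _]lieC (cenD e) // oppr0 addr0.
    rewrite -/(br p q) /phi; under eq_bigr do rewrite mE -bilZ.
    have -> : \sum_l bil (k l *: m l) p q = bil (\sum_l k l *: m l) p q.
      rewrite (big_morph (fun M => bil M p q) (id1 := 0) (op1 := +%R)) // => [M N|].
        exact: bilD.
      by rewrite /bil mulmx0 mul0mx mxE.
    have -> : \sum_l k l *: m l = 0.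
      by apply: etrans k0; apply: eq_bigr => l _; rewrite tE.
    by rewrite /bil mulmx0 mul0mx mxE.
  move=> i; have : Z`_i \in lie_derived g.
    by apply: (basis_mem bZ); rewrite mem_nth // size_tuple.
  move/(subvP Dphi); rewrite memv_ker lfunE /= /phi => /eqP <-.
  rewrite (bigD1 i) //= coord_free ?(basis_free bZ) // eqxx mulr1 big1 ?addr0 // => l li.
  by rewrite coord_free ?(basis_free bZ) // eq_sym (negbTE li) mulr0.
have sW M : M \in W -> skewsymmetric M.
  rewrite /W => MW; rewrite (coord_span MW) /skewsymmetric raddf_sum -sumrN.
  apply: eq_bigr => l _; rewrite tE; apply/matrixP => i j.
  by rewrite !mxE lieC linearN mulrN.
(* A common kernel vector would be central, hence in D, while it comes from a complement of D. *)
have kW (x : 'rV[R]_4) : (forall M, M \in W -> x *m M = 0) -> x = 0.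
  move=> H; pose u := \sum_i x 0 i *: v`_i.
  have uD : u \in lie_derived g.
    apply: cen => y; have [q [e eD ->]] := dec y.
    rewrite lieDl [lie_bracket e _]lieC (cenD e) // oppr0 addr0.
    rewrite lieC -/(br x q) brZ big1 ?oppr0 // => l _.
    by rewrite /bil H // mul0mx mxE scale0r.
  have uC : u \in (lie_derived g)^C%VS.
    by apply: memv_suml => i _; rewrite memvZ // (basis_mem bv) // mem_nth // size_tuple.
  have u0 : u = 0 by apply/eqP; rewrite -memv0 -(capv_compl (lie_derived g)) memv_cap uD.
  apply/rowP => i; rewrite mxE.
  by have /freeP := basis_free bv; apply => //.
have [P uP HP] := skew_net_normal_form dW sW kW.
pose u (n : nat) := \sum_i P (inord n) i *: v`_i.
have uE n : u n = \sum_i (row (inord n) P) 0 i *: v`_i.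
  by apply: eq_bigr => i _; rewrite mxE.
have brU i j : lie_bracket (u i) (u j) = \sum_l ent (P *m m l *m P^T) i j *: Z`_l.
  rewrite !uE -/(br _ _) brZ; apply: eq_bigr => l _; congr (_ *: _).
  by rewrite /ent -bil_delta -bil_mul -!rowE.
have spU : spanning4 (u 0%N) (u 1%N) (u 2%N) (u 3%N).
  apply/eqP; rewrite eqEsubv subvf; apply/subvP => x _.
  have [p [e eD ->]] := dec x; apply: memv_add => //.
  have -> : \sum_i p 0 i *: v`_i = \sum_(i < 4) (p *m invmx P) 0 i *: u i.
    transitivity (\sum_i (p *m invmx P *m P) 0 i *: v`_i); first by rewrite mulmxKV.
    under eq_bigr => i _ do rewrite mxE scaler_suml.
    rewrite exchange_big /=; apply: eq_bigr => i _; rewrite /u scaler_sumr.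
    by apply: eq_bigr => j _; rewrite inord_val scalerA.
  rewrite !big_ord_recl big_ord0 /= /bump /= !addn0.
  by rewrite !memvD ?mem0v // memvZ // memv_span // !inE eqxx ?orbT.
case: HP => [[a [b H]]|H].
  apply: (label_of_net d7 nil d3 spU (a := a) (b := b)).
  split; rewrite !brU ?scaler_sumr; apply: eq_bigr => l _; have [h1 h2 h3] := H _ (mW l).
  - by rewrite h1.
  - by rewrite h2 scalerA.
  - by rewrite h3 scalerA.
(* The common factor is the covector of index 0, whereas in 37A it is e^2: the first two vectors are
   exchanged. *)
exists L37A; apply: (@label_37A_of_relations _ _ d7 nil d3 (u 1%N) (u 0%N) (u 2%N) (u 3%N)).
- apply: (spanning4_trans spU) => w wu; rewrite memv_span //.
  by move: wu; rewrite !inE orbCA.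
- by rewrite brU big1 // => l _; have [-> _ _] := H _ (mW l); rewrite scale0r.
- by rewrite brU big1 // => l _; have [_ -> _] := H _ (mW l); rewrite scale0r.
- by rewrite brU big1 // => l _; have [_ _ ->] := H _ (mW l); rewrite scale0r.
Qed.

End DerivedThree.

(** * The bound on the dimension of the derived algebra *)

Section DerivedDimension.
Variables (K : fieldType) (g : lieAlgType K).

Lemma dim_derived_le3 : \dim (@fullv K g) = 7%N ->
  (forall x y z : g, lie_bracket x (lie_bracket y z) = 0) ->
  (\dim (lie_derived g) <= 3)%N.
Proof.
move=> d7 nil; rewrite leqNgt; apply/negP => d4.
have cenD := lie_derived_central nil.
pose s := vbasis (lie_derived g)^C.
have ss : (size s <= 3)%N by rewrite size_tuple dimv_compl d7; lia.
(* The default value 0 pads the basis of the complement to three vectors when it has fewer. *)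
pose w i := s`_i.
have dec x : exists a b c, exists2 e, e \in lie_derived g &
    x = a *: w 0%N + b *: w 1%N + c *: w 2%N + e.
  have : x \in ((lie_derived g)^C + lie_derived g)%VS by rewrite addvC addv_complf memvf.
  move=> /memv_addP [t tV [e eD ->]].
  have : t \in <<[:: w 0%N; w 1%N; w 2%N]>>%VS.
    have sE := span_basis (vbasisP (lie_derived g)^C).
    move: tV; rewrite -sE; apply: subvP; apply: sub_span.
    move=> y /(nthP 0) [i ilt <-]; have : (i < 3)%N := leq_trans ilt ss.
    by case: i {ilt} => [|[|[|i]]] // _; rewrite !inE eqxx ?orbT.
  move=> tS; rewrite (@coord_span _ _ _ (in_tuple _) t tS) 3!big_ord_recl big_ord0 /= addr0 !addrA.
  by do 3 eexists; exists e.
suff : (lie_derived g <= <<[:: lie_bracket (w 0%N) (w 1%N); lie_bracket (w 0%N) (w 2%N);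
    lie_bracket (w 1%N) (w 2%N)]>>)%VS.
  by move=> /dimvS H; have := leq_trans d4 (leq_trans H (dim_span _)).
apply: lie_derived_min => x y.
have [a [b [c [e eD ->]]]] := dec x; have [a' [b' [c' [e' e'D ->]]]] := dec y.
rewrite lieDr (cenD e') // addr0 lieDl [lie_bracket e _]lieC (cenD e) // oppr0 addr0.
rewrite !(lieDl, lieDr, lieZl, lieZr) !liexx.
rewrite (lieC (w 1%N) (w 0%N)) (lieC (w 2%N) (w 0%N)) (lieC (w 2%N) (w 1%N)).
by rewrite !scaler0 !memvD ?mem0v // ?scalerN ?memvN ?memvZ ?memvN ?memvZ // memv_span //
  !inE eqxx ?orbT.
Qed.

End DerivedDimension.

Lemma lie_isomorphic_refl (K : fieldType) (g : lieAlgType K) : lie_isomorphic g g.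
Proof. by exists idfun; split=> //; exists idfun. Qed.

Local Close Scope ring_scope.

Theorem theorem16 (R : realType) :
  (forall g : lieAlgType R,
     (\dim (fullv : {vspace g}) = 7 /\ indecomposable g /\
      two_step_nilpotent g /\ carries_coclosed_G2_structure g)
     <-> exists l : label, lie_isomorphic g (algebra_of_label R l))
  /\ (forall l m : label,
        lie_isomorphic (algebra_of_label R l) (algebra_of_label R m) -> l = m).
Proof.
split=> [g|l m lm]; last first.
  have [F lF] := (lie_isomorphic_label (algebra_of_label R l) l).1 (lie_isomorphic_refl _).
  have [G mG] := (lie_isomorphic_label (algebra_of_label R l) m).1 lm.
  exact: label_basis_unique lF mG.
split=> [[d7 [ind [[nab nil] [phi _ [E [bE ->] dE]]]]]|[l /lie_isomorphic_label [F lF]]];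
    last first.
  split; first exact: size_basis lF.1.
  split; first exact: label_indecomposable lF.
  by split; [exact: label_two_step lF | exact: label_coclosed lF].
rewrite hodge_star_G2_form // in dE.
have cen : center_in_derived g by apply: center_of_indecomposable ind; rewrite d7.
suff [l [F lF]] : exists l (F : 7.-tuple g), label_basis l F.
  by exists l; apply/lie_isomorphic_label; exists F.
have cenD := lie_derived_central nil.
have := dim_derived_le3 d7 nil; case dD : (\dim (lie_derived g)) => [|[|[|[|]]]] // _.
- case: nab => x y; apply/eqP; rewrite -memv0.
  by move/eqP: dD; rewrite dimv_eq0 => /eqP <-; exact: mem_lie_derived.
- have [z [z0 Dz]] : exists z, z != 0%R /\ lie_derived g = <[z]>%VS.
    exists (vpick (lie_derived g)); have z0 : vpick (lie_derived g) != 0%R.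
      by rewrite vpick0 -dimv_eq0 dD.
    split=> //; apply/esym/eqP; rewrite eqEdim dD dim_vline z0 andbT.
    by rewrite -memvE memv_pick.
  exists L17; apply: (label_17_of_line z0 Dz d7 cen) => x.
  by apply: cenD; rewrite Dz memv_line.
- by case: (derived_plane_center bE dE nil dD).
exact: label_of_derived3.
Qed.
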